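(* The equational theory of the time warp algebra $\mathbf{W}=\langle W,\wedge,\vee,\circ,\backslash,/,\mathrm{id},\bot,\top\rangle$ is decidable. That is, there is an algorithm which, given two time warp terms $s,t$, decides whether $\mathbf{W}\models s\approx t$, i.e. whether $s$ and $t$ evaluate to the same time warp under every assignment of time warps to the variables.
   Context: Let $\overline{\omega}=\omega\cup\{\omega\}$ be the natural numbers with a top element $\omega$ adjoined, with its natural total order. A time warp is a monotone map $f\colon\overline{\omega}\to\overline{\omega}$ with $f(0)=0$ and $f(\omega)=\bigvee\{f(n)\mid n\in\omega\}$ (equivalently, a sup-preserving map $\overline\omega\to\overline\omega$). Let $W$ be the set of time warps, ordered pointwise ($f\le g$ iff $f(p)\le g(p)$ for all $p$); $\wedge,\vee$ are the pointwise meet and join, $fg:=f\circ g$ is composition, $\mathrm{id}$ is the identity, $\bot$ is the constant map $0$, and $\top$ maps every $p\neq 0$ to $\omega$ (and $0$ to $0$). The residuals $\backslash,/$ are the binary operations on $W$ satisfying, for all $f,g,h\in W$: $f\le h/g \iff fg\le h \iff g\le f\backslash h$. The time warp algebra is $\mathbf{W}=\langle W,\wedge,\vee,\circ,\backslash,/,\mathrm{id},\bot,\top\rangle$. A time warp term is a term built from a countably infinite set of variables using the binary symbols $\wedge,\vee,\circ,\backslash,/$ and constants $\mathrm{id},\bot,\top$; an equation $s\approx t$ holds in $\mathbf{W}$ if both sides are equal under every valuation of variables in $W$. *)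

(* Defs.v *)
From Stdlib Require Import List Arith.
Import ListNotations.

Inductive omb : Type := Fin (n : nat) | Omega.

Definition leo (p q : omb) : Prop :=
  match p, q with
  | _, Omega => True
  | Fin m, Fin n => m <= n
  | Omega, Fin _ => False
  end.

Definition mino (p q : omb) : omb :=
  match p, q with
  | Omega, x => x
  | x, Omega => x
  | Fin m, Fin n => Fin (Nat.min m n)
  end.

Definition maxo (p q : omb) : omb :=
  match p, q with
  | Omega, _ => Omega
  | _, Omega => Omega
  | Fin m, Fin n => Fin (Nat.max m n)
  end.

Definition warp_fun := omb -> omb.

Definition is_warp (f : warp_fun) : Prop :=
  (forall p q, leo p q -> leo (f p) (f q)) /\
  f (Fin 0) = Fin 0 /\
  (forall n, leo (f (Fin n)) (f Omega)) /\
  (forall u, (forall n, leo (f (Fin n)) u) -> leo (f Omega) u).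

Definition lew (f g : warp_fun) : Prop := forall p, leo (f p) (g p).

Definition w_id : warp_fun := fun p => p.
Definition w_bot : warp_fun := fun _ => Fin 0.
Definition w_top : warp_fun :=
  fun p => match p with Fin 0 => Fin 0 | _ => Omega end.

Inductive tterm : Type :=
| TVar (n : nat)
| TMeet (s t : tterm)
| TJoin (s t : tterm)
| TComp (s t : tterm)
| TLdiv (s t : tterm)
| TRdiv (s t : tterm)
| TId | TBot | TTop.

(** Evaluation in W, as a relation.  The residuals are specified by their
    defining property: for warps f, g, the value r of f \ g is the warp with
    (forall warp k, k <= r <-> f k <= g), and the value r of f / g is the warp
    with (forall warp k, k <= r <-> k g <= f).  Such r exists and is unique. *)
Inductive evalW (v : nat -> warp_fun) : tterm -> warp_fun -> Prop :=
| ev_var n : evalW v (TVar n) (v n)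
| ev_meet s t f g : evalW v s f -> evalW v t g ->
    evalW v (TMeet s t) (fun p => mino (f p) (g p))
| ev_join s t f g : evalW v s f -> evalW v t g ->
    evalW v (TJoin s t) (fun p => maxo (f p) (g p))
| ev_comp s t f g : evalW v s f -> evalW v t g ->
    evalW v (TComp s t) (fun p => f (g p))
| ev_ldiv s t f g r : evalW v s f -> evalW v t g -> is_warp r ->
    (forall k, is_warp k -> (lew k r <-> lew (fun p => f (k p)) g)) ->
    evalW v (TLdiv s t) r
| ev_rdiv s t f g r : evalW v s f -> evalW v t g -> is_warp r ->
    (forall k, is_warp k -> (lew k r <-> lew (fun p => k (g p)) f)) ->
    evalW v (TRdiv s t) r
| ev_id : evalW v TId w_id
| ev_bot : evalW v TBot w_bot
| ev_top : evalW v TTop w_top.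

Definition W_models (s t : tterm) : Prop :=
  forall v : nat -> warp_fun, (forall n, is_warp (v n)) ->
  forall f g, evalW v s f -> evalW v t g -> forall p, f p = g p.

(** * Model of computation: mu-recursive functions on nat
    (arguments given as a list; missing arguments read as 0). *)
Inductive recf : Type :=
| RZero
| RSucc
| RProj (i : nat)
| RComp (f : recf) (gs : list recf)
| RPrec (f g : recf)
| RMu (f : recf).

Inductive reval : recf -> list nat -> nat -> Prop :=
| re_zero xs : reval RZero xs 0
| re_succ xs : reval RSucc xs (S (hd 0 xs))
| re_proj i xs : reval (RProj i) xs (nth i xs 0)
| re_comp f gs xs ys y :
    Forall2 (fun g y => reval g xs y) gs ys ->
    reval f ys y -> reval (RComp f gs) xs y
| re_prec0 f g xs y : reval f xs y -> reval (RPrec f g) (0 :: xs) y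
| re_precS f g n xs z y :
    reval (RPrec f g) (n :: xs) z -> reval g (n :: z :: xs) y ->
    reval (RPrec f g) (S n :: xs) y
| re_mu f xs n :
    reval f (n :: xs) 0 ->
    (forall m, m < n -> exists k, reval f (m :: xs) (S k)) ->
    reval (RMu f) xs n.

(** * Goedel numbering of terms (Cantor pairing) *)
Definition cpair (a b : nat) : nat := (a + b) * (a + b + 1) / 2 + b.

Fixpoint code (t : tterm) : nat :=
  match t with
  | TVar n => cpair 0 n
  | TMeet s u => cpair 1 (cpair (code s) (code u))
  | TJoin s u => cpair 2 (cpair (code s) (code u))
  | TComp s u => cpair 3 (cpair (code s) (code u))
  | TLdiv s u => cpair 4 (cpair (code s) (code u))
  | TRdiv s u => cpair 5 (cpair (code s) (code u))
  | TId => cpair 6 0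
  | TBot => cpair 7 0
  | TTop => cpair 8 0
  end.

(* Main.v *)
Require Import Defs.
From Stdlib Require Import List Arith Lia Bool Cantor Wf_nat.
From Stdlib Require Import Classical ClassicalEpsilon.
Import ListNotations.

(** The decision procedure rests on a small model property.  The value of a term at a
    point is determined by the values of the variables at finitely many points, provided
    one also records, for each variable, whether it is unbounded with finite values at all
    finite points: a residual at a finite point is pinned down by two consecutive
    arguments, and its value at omega by this flag together with a point where the supremum
    is attained, if there is one.  The number of points needed is bounded by a function of
    the term.  Replacing these points by their ranks preserves the order, 0, omega and the
    immediate successors among them, and hence all the conditions involved, so a failing
    equation fails on tables of computable size.  Conversely every monotone table extends
    to a time warp.  It remains to search the finitely many tables, which a recursive
    function can do by recursion on term codes. *)

(** The obstacle is omega. Finitely many values of [g] do not reveal whether [g] climbs to omega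
    only in the limit, yet the value of the left residual of [g] by [f] at omega depends on it: for
    such [g] it is omega if [f] stays finite at finite arguments, and otherwise the last argument
    before [f] jumps to omega. This is what the flag records. Tables are partial and read in one
    direction only: an entry asserts something, a missing entry asserts nothing. What is derived
    from a table therefore holds for every warp that fits it, and an equation is refuted by two
    different derived entries at one point. Completeness is pointwise: for each single point some
    sample of bounded size makes the entry derivable. Since ranks change when a sample grows, this
    is claimed for all larger samples of length below [W], so that the samples for subterms can
    simply be merged. Classical logic and choice enter only the correctness proof; the procedure is
    an explicit element of [recf]. *)

Arguments cpair : simpl never.

(** * Cantor pairing *)

Definition fst1 (n : nat) : nat := fst (Cantor.of_nat n).
Definition snd1 (n : nat) : nat := snd (Cantor.of_nat n).
Arguments fst1 : simpl never.
Arguments snd1 : simpl never.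

(** Triangular numbers as an iteration, the form that the library's Cantor coding uses and that
    [RPrec] realises directly. *)
Definition tri (n : nat) : nat := nat_rect _ 0 (fun i z => S i + z) n.

Lemma cpair_tri a b : cpair a b = tri (a + b) + b.
Proof.
  unfold cpair; f_equal.
  assert (H : forall n, n * (n + 1) = tri n * 2).
  { induction n as [|n IH]; [reflexivity|]. cbn [tri nat_rect]. fold (tri n). lia. }
  now rewrite H, Nat.div_mul.
Qed.

Lemma cpair_to_nat a b : cpair a b = Cantor.to_nat (a, b).
Proof.
  rewrite cpair_tri. unfold Cantor.to_nat, tri.
  now rewrite (Nat.add_comm a b), Nat.add_comm.
Qed.

Lemma fst1_cpair a b : fst1 (cpair a b) = a.
Proof. unfold fst1. now rewrite cpair_to_nat, Cantor.cancel_of_to. Qed.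

Lemma snd1_cpair a b : snd1 (cpair a b) = b.
Proof. unfold snd1. now rewrite cpair_to_nat, Cantor.cancel_of_to. Qed.

Ltac unpair := repeat first [rewrite fst1_cpair | rewrite snd1_cpair].

Lemma cpair_eta n : cpair (fst1 n) (snd1 n) = n.
Proof.
  unfold fst1, snd1. rewrite cpair_to_nat, <- surjective_pairing.
  apply Cantor.cancel_to_of.
Qed.

Lemma tri_le m n : m <= n -> tri m <= tri n.
Proof.
  induction 1 as [|n _ IH]; [easy|]. cbn [tri nat_rect]. fold (tri n). lia.
Qed.

Lemma cpair_mono a b a' b' : a <= a' -> b <= b' -> cpair a b <= cpair a' b'.
Proof.
  intros. rewrite !cpair_tri. pose proof (tri_le (a + b) (a' + b')). lia.
Qed.

Lemma cpair_ge a b : a + b <= cpair a b.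
Proof.
  rewrite cpair_tri.
  assert (H : forall n, n <= tri n).
  { induction n as [|n IH]; [easy|]. cbn [tri nat_rect]. lia. }
  specialize (H (a + b)).
  destruct b as [|b]; [lia|].
  replace (a + S b) with (S (a + b)) in * by lia. lia.
Qed.

(** Justifies course-of-values recursion on term codes, and passes a bound on the code of a term
    down to its subterms. *)
Lemma cpair_gt k a b : 0 < k -> a < cpair k (cpair a b) /\ b < cpair k (cpair a b).
Proof.
  intros. pose proof (cpair_ge k (cpair a b)). pose proof (cpair_ge a b). lia.
Qed.

(** * Recursive functions *)

Definition rec2 (f : nat -> nat -> nat) : Prop :=
  exists r, forall x y, reval r [x; y] (f x y).

Definition rec1 (f : nat -> nat) : Prop := exists r, forall x, reval r [x] (f x).

Lemma reval_proj i xs y : nth i xs 0 = y -> reval (RProj i) xs y.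
Proof. intros <-. constructor. Qed.

Lemma reval_succ x xs : reval RSucc (x :: xs) (S x).
Proof. exact (re_succ (x :: xs)). Qed.

Lemma reval_comp1 f g xs x y : reval g xs x -> reval f [x] y -> reval (RComp f [g]) xs y.
Proof. intros; econstructor; [|eassumption]; eauto. Qed.

Lemma reval_comp2 f g h xs x y z :
  reval g xs x -> reval h xs y -> reval f [x; y] z -> reval (RComp f [g; h]) xs z.
Proof. intros; econstructor; [|eassumption]; eauto. Qed.

Lemma rec2_iter (f : nat -> nat) (g : nat -> nat -> nat) :
  rec1 f -> rec2 g ->
  rec2 (fun n x => nat_rect _ (f x) (fun i z => g i z) n).
Proof.
  intros [rf Hf] [rg Hg].
  exists (RPrec rf (RComp rg [RProj 0; RProj 1])).
  intros n x. induction n as [|n IH]; cbn.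
  - now constructor.
  - econstructor; [exact IH|]. eapply reval_comp2; try apply re_proj. apply Hg.
Qed.

Lemma rec1_id : rec1 (fun x => x).
Proof. exists (RProj 0). intros; now apply reval_proj. Qed.

Lemma rec1_const c : rec1 (fun _ => c).
Proof.
  induction c as [|c [r Hr]].
  - exists RZero. constructor.
  - exists (RComp RSucc [r]). intros. eapply reval_comp1; eauto using reval_succ.
Qed.

Lemma rec2_add : rec2 Nat.add.
Proof.
  destruct (rec2_iter (fun x => x) (fun _ z => S z) rec1_id) as [r Hr].
  - exists (RComp RSucc [RProj 1]). intros. eapply reval_comp1; eauto using re_proj, reval_succ.
  - exists r. intros x y. specialize (Hr x y).
    replace (x + y) with (nat_rect (fun _ => nat) y (fun _ z => S z) x); [easy|].
    clear Hr. induction x as [|x IH]; cbn; auto.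
Qed.

Lemma rec1_comp f g : rec1 f -> rec1 g -> rec1 (fun e => f (g e)).
Proof.
  intros [r Hr] [s Hs]. exists (RComp r [s]). intros. eapply reval_comp1; eauto.
Qed.

Lemma rec1_comp2 h f g : rec2 h -> rec1 f -> rec1 g -> rec1 (fun e => h (f e) (g e)).
Proof.
  intros [t Ht] [r Hr] [s Hs]. exists (RComp t [r; s]). intros. eapply reval_comp2; eauto.
Qed.

Lemma rec2_swap f : rec2 f -> rec2 (fun x y => f y x).
Proof.
  intros [r Hr]. exists (RComp r [RProj 1; RProj 0]). intros.
  eapply reval_comp2; try apply re_proj. apply Hr.
Qed.

Lemma rec2_comp f g : rec1 f -> rec2 g -> rec2 (fun x y => f (g x y)).
Proof.
  intros [r Hr] [s Hs]. exists (RComp r [s]). intros. eapply reval_comp1; eauto.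
Qed.

Lemma rec2_comp2 f g h : rec2 f -> rec2 g -> rec2 h -> rec2 (fun x y => f (g x y) (h x y)).
Proof.
  intros [r Hr] [s Hs] [t Ht]. exists (RComp r [s; t]). intros. eapply reval_comp2; eauto.
Qed.

Lemma rec2_fst : rec2 (fun x _ => x).
Proof. exists (RProj 0). intros; now apply reval_proj. Qed.

Lemma rec2_snd : rec2 (fun _ y => y).
Proof. exists (RProj 1). intros; now apply reval_proj. Qed.

Lemma rec1_S : rec1 S.
Proof. exists RSucc. intros; apply reval_succ. Qed.

Lemma rec1_diag f : rec2 f -> rec1 (fun x => f x x).
Proof. intros. now apply (rec1_comp2 f (fun x => x) (fun x => x)); auto using rec1_id. Qed.

Lemma rec1_tri : rec1 tri.
Proof.
  apply (rec1_diag (fun n x => nat_rect _ 0 (fun i z => S i + z) n)).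
  apply (rec2_iter (fun _ => 0)); [apply rec1_const|].
  apply rec2_comp2; auto using rec2_add, rec2_snd.
  apply rec2_comp; auto using rec1_S, rec2_fst.
Qed.

Lemma rec1_pred : rec1 Nat.pred.
Proof.
  destruct (rec2_iter (fun _ => 0) (fun i _ => i) (rec1_const 0) rec2_fst) as [r Hr].
  exists (RComp r [RProj 0; RProj 0]). intros x.
  eapply reval_comp2; try apply re_proj. cbn.
  specialize (Hr x x). now destruct x.
Qed.

Lemma rec2_sub : rec2 Nat.sub.
Proof.
  apply (rec2_swap (fun y x => x - y)).
  destruct (rec2_iter (fun x => x) (fun _ z => Nat.pred z) rec1_id) as [r Hr].
  - apply (rec2_comp _ _ rec1_pred rec2_snd).
  - exists r. intros y x. specialize (Hr y x).
    replace (x - y) with (nat_rect (fun _ => nat) x (fun _ z => Nat.pred z) y); [easy|].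
    clear Hr. induction y as [|y IH]; cbn; [|rewrite IH]; lia.
Qed.

Lemma rec2_cpair : rec2 cpair.
Proof.
  destruct (rec2_comp2 Nat.add _ (fun _ b => b) rec2_add
              (rec2_comp tri Nat.add rec1_tri rec2_add) rec2_snd) as [r Hr].
  exists r. intros. rewrite cpair_tri. apply Hr.
Qed.

Lemma rec1_diagonal : rec1 (fun z => fst1 z + snd1 z).
Proof.
  (* The sum of the components of [z] is the least [s] with [z < tri (s + 1)]. *)
  assert (Hd : rec2 (fun s z => S z - tri (S s))).
  { apply rec2_comp2; [apply rec2_sub| |].
    - apply rec2_comp; auto using rec1_S, rec2_snd.
    - apply (rec2_comp tri); auto using rec1_tri.
      apply rec2_comp; auto using rec1_S, rec2_fst. }
  destruct Hd as [r Hr]. exists (RMu r). intros z.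
  pose proof (cpair_eta z) as Hz. rewrite cpair_tri in Hz.
  set (s := fst1 z + snd1 z) in *.
  assert (Hs : tri (S s) = S s + tri s) by reflexivity.
  constructor.
  - specialize (Hr s z).
    replace (S z - tri (S s)) with 0 in Hr by lia. exact Hr.
  - intros m Hm. exists (z - tri (S m)).
    pose proof (tri_le (S m) s Hm).
    specialize (Hr m z).
    replace (S (z - tri (S m))) with (S z - tri (S m)) by lia. exact Hr.
Qed.

Lemma rec1_ext f g : rec1 f -> (forall e, g e = f e) -> rec1 g.
Proof. intros [r Hr] H. exists r. intros. rewrite H. apply Hr. Qed.

Lemma rec1_snd1 : rec1 snd1.
Proof.
  eapply rec1_ext.
  - apply (rec1_comp2 Nat.sub (fun z => z) (fun z => tri (fst1 z + snd1 z))).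
    + apply rec2_sub.
    + apply rec1_id.
    + apply rec1_comp; auto using rec1_tri, rec1_diagonal.
  - intros z. pose proof (cpair_eta z) as Hz. rewrite cpair_tri in Hz. cbn. lia.
Qed.

Lemma rec1_fst1 : rec1 fst1.
Proof.
  eapply rec1_ext.
  - apply (rec1_comp2 Nat.sub (fun z => fst1 z + snd1 z) snd1);
      auto using rec2_sub, rec1_diagonal, rec1_snd1.
  - intros z. cbn. lia.
Qed.

(* Environments are single numbers: a bound variable is pushed with [cpair] and read
   back with [fst1], so every closure property only concerns unary functions. *)
Lemma rec1_nat_rect b f g :
  rec1 b -> rec1 f -> rec1 (fun e => g (snd1 (snd1 e)) (fst1 e) (fst1 (snd1 e))) ->
  rec1 (fun e => nat_rect (fun _ => nat) (f e) (g e) (b e)).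
Proof.
  intros [rb Hb] [rf Hf] [rg Hg]. destruct rec2_cpair as [rp Hp].
  (* [RPrec] supplies counter, accumulator and parameter as a list; they are packed into the one
     environment that the hypothesis on [g] unpacks. *)
  exists (RComp (RPrec rf
    (RComp rg [RComp rp [RProj 0; RComp rp [RProj 1; RProj 2]]])) [rb; RProj 0]).
  intros e. eapply reval_comp2; [apply Hb|apply re_proj|]. cbn.
  generalize (b e) as n. induction n as [|n IH]; cbn.
  - constructor. apply Hf.
  - econstructor; [exact IH|].
    eapply reval_comp1.
    + eapply reval_comp2; [apply re_proj| |apply Hp].
      eapply reval_comp2; [apply re_proj|apply re_proj|apply Hp].
    + cbn. match goal with |- reval _ [?c] _ => specialize (Hg c) end.
      now rewrite !snd1_cpair, !fst1_cpair in Hg.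
Qed.

Lemma rec1_mul f g : rec1 f -> rec1 g -> rec1 (fun e => f e * g e).
Proof.
  intros Hf Hg. eapply rec1_ext.
  - apply (rec1_nat_rect f (fun _ => 0) (fun e _ z => g e + z)); auto using rec1_const.
    apply (rec1_comp2 Nat.add); [apply rec2_add| |].
    + apply (rec1_comp g); auto. apply rec1_comp; auto using rec1_snd1.
    + apply rec1_comp; auto using rec1_fst1, rec1_snd1.
  - intros e. cbn. induction (f e) as [|n IH]; cbn; congruence.
Qed.

(** * Finite sequences coded as numbers *)

Definition get (T i : nat) : nat := fst1 (nat_rect _ T (fun _ => snd1) i).

(** A sequence is a right-nested pair ending in 0. Every number can be read with [get], so a search
    for tables may run through all numbers up to a bound. *)
Definition tab (M : nat) (g : nat -> nat) : nat := fold_right cpair 0 (map g (seq 0 M)).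

Lemma get_0 x T : get (cpair x T) 0 = x.
Proof. apply fst1_cpair. Qed.

Lemma get_S x T i : get (cpair x T) (S i) = get T i.
Proof.
  unfold get. f_equal. induction i as [|i IH]; cbn in *; [apply snd1_cpair|congruence].
Qed.

Lemma get_tab M g i : i < M -> get (tab M g) i = g i.
Proof.
  enough (H : forall k i, i < M ->
    get (fold_right cpair 0 (map g (seq k M))) i = g (k + i)) by exact (H 0 i).
  induction M as [|M IH]; clear i; intros k i Hi; [lia|]. cbn.
  destruct i as [|i].
  - now rewrite get_0, Nat.add_0_r.
  - rewrite get_S, IH by lia. f_equal; lia.
Qed.

(** Bounds the codes of all tables with entries at most 1, which makes the search finite. *)
Lemma tab_mono M g h : (forall i, g i <= h i) -> tab M g <= tab M h.
Proof.
  intros H. unfold tab. induction (seq 0 M); cbn; [easy|]. now apply cpair_mono.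
Qed.

Lemma rec1_get f g : rec1 f -> rec1 g -> rec1 (fun e => get (f e) (g e)).
Proof.
  intros Hf Hg. apply (rec1_comp fst1); auto using rec1_fst1.
  apply (rec1_nat_rect g f (fun _ _ => snd1)); auto.
  apply (rec1_comp snd1), rec1_comp; auto using rec1_snd1, rec1_fst1.
Qed.

Lemma rec1_tab (b : nat -> nat) (g : nat -> nat -> nat) :
  rec1 b -> rec1 (fun e => g (snd1 e) (fst1 e)) -> rec1 (fun e => tab (b e) (g e)).
Proof.
  intros Hb Hg. eapply rec1_ext.
  (* The sequence is built from its end: round [k] prepends the entry with index [b e - S k]. *)
  - apply (rec1_nat_rect b (fun _ => 0) (fun e k z => cpair (g e (b e - S k)) z));
      auto using rec1_const.
    apply (rec1_comp2 cpair); [apply rec2_cpair| |apply rec1_comp; auto using rec1_fst1, rec1_snd1].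
    assert (He : rec1 (fun e => snd1 (snd1 e))) by (apply rec1_comp; auto using rec1_snd1).
    eapply rec1_ext.
    + apply (rec1_comp _ (fun e => cpair (b (snd1 (snd1 e)) - S (fst1 e)) (snd1 (snd1 e))) Hg).
      apply (rec1_comp2 cpair); [apply rec2_cpair| |exact He].
      apply (rec1_comp2 Nat.sub); [apply rec2_sub| |].
      * now apply rec1_comp.
      * apply rec1_comp; auto using rec1_S, rec1_fst1.
    + intros e. cbn. now rewrite fst1_cpair, snd1_cpair.
  - intros e. cbn. unfold tab.
    enough (H : forall k, k <= b e ->
      fold_right cpair 0 (map (g e) (seq (b e - k) k)) =
      nat_rect (fun _ => nat) 0 (fun k z => cpair (g e (b e - S k)) z) k).
    { specialize (H (b e)). rewrite Nat.sub_diag in H. now apply H. }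
    induction k as [|k IH]; intros Hk; [easy|]. cbn.
    rewrite <- IH by lia. now replace (S (b e - S k)) with (b e - k) by lia.
Qed.

(** * Closure under tests and bounded quantifiers *)

Lemma rec1_add f g : rec1 f -> rec1 g -> rec1 (fun e => f e + g e).
Proof. apply rec1_comp2, rec2_add. Qed.

Lemma rec1_sub f g : rec1 f -> rec1 g -> rec1 (fun e => f e - g e).
Proof. apply rec1_comp2, rec2_sub. Qed.

Lemma rec1_cpair f g : rec1 f -> rec1 g -> rec1 (fun e => cpair (f e) (g e)).
Proof. apply rec1_comp2, rec2_cpair. Qed.

(** Truth values are the numbers 0 and 1, so a conditional is a sum of two products; evaluating both
    branches is harmless for total functions. *)
Lemma rec1_if (c : nat -> bool) f g :
  rec1 (fun e => Nat.b2n (c e)) -> rec1 f -> rec1 g ->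
  rec1 (fun e => if c e then f e else g e).
Proof.
  intros Hc Hf Hg. eapply rec1_ext.
  - apply rec1_add; [apply (rec1_mul _ f Hc Hf)|].
    apply (rec1_mul (fun e => 1 - Nat.b2n (c e)) g); [apply (rec1_sub _ _ (rec1_const 1) Hc)|exact Hg].
  - intros e. cbn. destruct (c e); cbn; lia.
Qed.

Lemma rec1_negb P : rec1 (fun e => Nat.b2n (P e)) -> rec1 (fun e => Nat.b2n (negb (P e))).
Proof.
  intros H. eapply rec1_ext; [apply (rec1_sub _ _ (rec1_const 1) H)|].
  intros e; cbn. now destruct (P e).
Qed.

Lemma rec1_andb P Q : rec1 (fun e => Nat.b2n (P e)) -> rec1 (fun e => Nat.b2n (Q e)) ->
  rec1 (fun e => Nat.b2n (P e && Q e)).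
Proof.
  intros H K. eapply rec1_ext; [apply (rec1_mul _ _ H K)|].
  intros e; cbn. now destruct (P e), (Q e).
Qed.

Lemma rec1_orb P Q : rec1 (fun e => Nat.b2n (P e)) -> rec1 (fun e => Nat.b2n (Q e)) ->
  rec1 (fun e => Nat.b2n (P e || Q e)).
Proof.
  intros H K. eapply rec1_ext; [apply (rec1_if P (fun _ => 1) _ H (rec1_const 1) K)|].
  intros e; cbn. now destruct (P e).
Qed.

Lemma rec1_boolif (c P Q : nat -> bool) :
  rec1 (fun e => Nat.b2n (c e)) -> rec1 (fun e => Nat.b2n (P e)) ->
  rec1 (fun e => Nat.b2n (Q e)) ->
  rec1 (fun e => Nat.b2n (if c e then P e else Q e)).
Proof.
  intros Hc HP HQ. eapply rec1_ext; [apply (rec1_if c _ _ Hc HP HQ)|].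
  intros e; cbn. now destruct (c e).
Qed.

Lemma rec1_leb f g : rec1 f -> rec1 g -> rec1 (fun e => Nat.b2n (f e <=? g e)).
Proof.
  intros Hf Hg. eapply rec1_ext.
  - apply (rec1_sub _ _ (rec1_const 1) (rec1_sub _ _ Hf Hg)).
  - intros e; cbn -[Nat.sub]. destruct (Nat.leb_spec (f e) (g e)); cbn -[Nat.sub]; lia.
Qed.

Lemma rec1_succ f : rec1 f -> rec1 (fun e => S (f e)).
Proof. apply rec1_comp, rec1_S. Qed.

Lemma rec1_ltb f g : rec1 f -> rec1 g -> rec1 (fun e => Nat.b2n (f e <? g e)).
Proof. intros Hf Hg. exact (rec1_leb _ _ (rec1_succ f Hf) Hg). Qed.

Lemma rec1_eqb f g : rec1 f -> rec1 g -> rec1 (fun e => Nat.b2n (f e =? g e)).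
Proof.
  intros Hf Hg. eapply rec1_ext.
  - apply rec1_andb; [exact (rec1_leb _ _ Hf Hg)|exact (rec1_leb _ _ Hg Hf)].
  - intros e; cbn. f_equal.
    destruct (Nat.eqb_spec (f e) (g e)), (Nat.leb_spec (f e) (g e)), (Nat.leb_spec (g e) (f e));
      cbn; lia.
Qed.

Lemma rec1_existsb (b : nat -> nat) (P : nat -> nat -> bool) :
  rec1 b -> rec1 (fun e => Nat.b2n (P (snd1 e) (fst1 e))) ->
  rec1 (fun e => Nat.b2n (existsb (P e) (seq 0 (b e)))).
Proof.
  intros Hb HP. eapply rec1_ext.
  - apply (rec1_nat_rect b (fun _ => 0) (fun e k z => if P e k then 1 else z));
      auto using rec1_const.
    apply rec1_if; [|apply rec1_const|apply rec1_comp; auto using rec1_fst1, rec1_snd1].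
    eapply rec1_ext.
    + apply (rec1_comp _ (fun e => cpair (fst1 e) (snd1 (snd1 e))) HP).
      apply rec1_cpair; [apply rec1_fst1|apply rec1_comp; auto using rec1_snd1].
    + intros e. cbn. now rewrite fst1_cpair, snd1_cpair.
  - intros e. cbn. induction (b e) as [|k IH]; [easy|].
    rewrite seq_S, existsb_app. cbn. rewrite <- IH.
    now destruct (existsb (P e) (seq 0 k)), (P e k).
Qed.

Lemma rec1_forallb (b : nat -> nat) (P : nat -> nat -> bool) :
  rec1 b -> rec1 (fun e => Nat.b2n (P (snd1 e) (fst1 e))) ->
  rec1 (fun e => Nat.b2n (forallb (P e) (seq 0 (b e)))).
Proof.
  intros Hb HP. eapply rec1_ext.
  - apply rec1_negb, (rec1_existsb b (fun e k => negb (P e k))); [exact Hb|].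
    exact (rec1_negb _ HP).
  - intros e. cbn. f_equal. induction (seq 0 (b e)) as [|x l IH]; [easy|].
    cbn. rewrite IH. now destruct (P e x).
Qed.

(** Lets [rec1_auto] apply a binary function known only in paired form, as delivered by
    [rec1_tfold]. *)
Lemma rec1_uncurry F f g : rec1 (fun x => F (fst1 x) (snd1 x)) ->
  rec1 f -> rec1 g -> rec1 (fun e => F (f e) (g e)).
Proof.
  intros HF Hf Hg. eapply rec1_ext.
  - apply (rec1_comp _ (fun e => cpair (f e) (g e)) HF). now apply rec1_cpair.
  - intros e. cbn. now unpair.
Qed.

(** Follows the syntax of the body. Under [tab], [existsb] and [forallb] the bound variable becomes
    [fst1] and the outer environment [snd1], so the goal again concerns a unary function. *)
Ltac rec1_auto :=
  lazymatch goal with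
  | |- rec1 (fun e => e) => exact rec1_id
  | |- rec1 (fun _ => ?c) => exact (rec1_const c)
  | |- rec1 (fun e => fst1 (@?f e)) => apply (rec1_comp fst1 f rec1_fst1); rec1_auto
  | |- rec1 (fun e => snd1 (@?f e)) => apply (rec1_comp snd1 f rec1_snd1); rec1_auto
  | |- rec1 (fun e => S (@?f e)) => apply (rec1_succ f); rec1_auto
  | |- rec1 (fun e => @?f e + @?g e) => apply (rec1_add f g); rec1_auto
  | |- rec1 (fun e => @?f e - @?g e) => apply (rec1_sub f g); rec1_auto
  | |- rec1 (fun e => @?f e * @?g e) => apply (rec1_mul f g); rec1_auto
  | |- rec1 (fun e => cpair (@?f e) (@?g e)) => apply (rec1_cpair f g); rec1_auto
  | |- rec1 (fun e => get (@?f e) (@?g e)) => apply (rec1_get f g); rec1_auto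
  | |- rec1 (fun e => tab (@?f e) (fun i => @?g e i)) =>
      apply (rec1_tab f g); cbv beta; rec1_auto
  | |- rec1 (fun e => Nat.b2n (negb (@?f e))) => apply (rec1_negb f); rec1_auto
  | |- rec1 (fun e => Nat.b2n (andb (@?f e) (@?g e))) => apply (rec1_andb f g); rec1_auto
  | |- rec1 (fun e => Nat.b2n (orb (@?f e) (@?g e))) => apply (rec1_orb f g); rec1_auto
  | |- rec1 (fun e => Nat.b2n (Nat.leb (@?f e) (@?g e))) => apply (rec1_leb f g); rec1_auto
  | |- rec1 (fun e => Nat.b2n (Nat.ltb (@?f e) (@?g e))) => apply (rec1_ltb f g); rec1_auto
  | |- rec1 (fun e => Nat.b2n (Nat.eqb (@?f e) (@?g e))) => apply (rec1_eqb f g); rec1_auto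
  | |- rec1 (fun e => Nat.b2n (existsb (fun i => @?P e i) (seq 0 (@?b e)))) =>
      apply (rec1_existsb b P); cbv beta; rec1_auto
  | |- rec1 (fun e => Nat.b2n (forallb (fun i => @?P e i) (seq 0 (@?b e)))) =>
      apply (rec1_forallb b P); cbv beta; rec1_auto
  | |- rec1 (fun e => Nat.b2n (if @?c e then @?f e else @?g e)) =>
      apply (rec1_boolif c f g); rec1_auto
  | |- rec1 (fun e => if @?c e then @?f e else @?g e) => apply (rec1_if c f g); rec1_auto
  | H : rec1 (fun x => ?F (fst1 x) (snd1 x)) |- rec1 (fun e => ?F (@?f e) (@?g e)) =>
      apply (rec1_uncurry F f g H); rec1_auto
  | |- rec1 _ => first
      [ assumption | exact rec1_fst1 | exact rec1_snd1
      | match goal with H : rec1 ?F |- rec1 (fun e => ?F (@?f e)) =>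
          apply (rec1_comp F f H); rec1_auto end
      | idtac ]
  end.

(** * Structural recursion on term codes *)

(** The tags are those of [code], so that a recursion on codes can imitate the fold. Both tables and
    sample sizes are instances. *)
Fixpoint tfold (var : nat -> nat) (op : nat -> nat -> nat -> nat) (t : tterm) : nat :=
  match t with
  | TVar n => var n
  | TMeet s u => op 1 (tfold var op s) (tfold var op u)
  | TJoin s u => op 2 (tfold var op s) (tfold var op u)
  | TComp s u => op 3 (tfold var op s) (tfold var op u)
  | TLdiv s u => op 4 (tfold var op s) (tfold var op u)
  | TRdiv s u => op 5 (tfold var op s) (tfold var op u)
  | TId => op 6 0 0
  | TBot => op 7 0 0
  | TTop => op 8 0 0
  end.

(** Course-of-values recursion on codes. The payload 0 of a constant is decoded as two subcodes 0,
    which feed meaningless values to [op]; the third hypothesis makes [op] ignore them. *)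
Lemma rec1_tfold (var : nat -> nat -> nat) (op : nat -> nat -> nat -> nat -> nat) :
  rec1 (fun e => var (fst1 e) (snd1 e)) ->
  rec1 (fun e => op (fst1 e) (fst1 (snd1 e)) (fst1 (snd1 (snd1 e))) (snd1 (snd1 (snd1 e)))) ->
  (forall e k x y, 6 <= k -> op e k x y = op e k 0 0) ->
  exists F, rec1 (fun x => F (fst1 x) (snd1 x)) /\
    forall e t, F e (code t) = tfold (var e) (op e) t.
Proof.
  intros Hvar Hop Hleaf.
  (* [hist e n] lists the values at [n-1, ..., 0]. *)
  set (step := fun e n h =>
    if fst1 n =? 0 then var e (snd1 n)
    else op e (fst1 n) (get h (n - S (fst1 (snd1 n)))) (get h (n - S (snd1 (snd1 n))))).
  set (hist := fun e n => nat_rect (fun _ => nat) 0 (fun n h => cpair (step e n h) h) n).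
  assert (Hget : forall e n m, m < n -> get (hist e n) (n - S m) = step e m (hist e m)).
  { intros e n. induction n as [|n IH]; intros m Hm; [lia|].
    change (hist e (S n)) with (cpair (step e n (hist e n)) (hist e n)).
    destruct (Nat.eq_dec m n) as [->|].
    - rewrite Nat.sub_diag. apply get_0.
    - replace (S n - S m) with (S (n - S m)) by lia. rewrite get_S. apply IH; lia. }
  exists (fun e n => step e n (hist e n)). split.
  - assert (Hstep : rec1 (fun e => step (fst1 e) (fst1 (snd1 e)) (snd1 (snd1 e)))).
    { unfold step. apply rec1_if; [rec1_auto| |].
      - rec1_auto.
      - set (k := fun e => fst1 (fst1 (snd1 e))).
        set (x := fun e => get (snd1 (snd1 e)) (fst1 (snd1 e) - S (fst1 (snd1 (fst1 (snd1 e)))))).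
        set (y := fun e => get (snd1 (snd1 e)) (fst1 (snd1 e) - S (snd1 (snd1 (fst1 (snd1 e)))))).
        eapply rec1_ext.
        + apply (rec1_comp _ (fun e => cpair (fst1 e) (cpair (k e) (cpair (x e) (y e)))) Hop).
          unfold k, x, y. rec1_auto.
        + intros e; cbn. now unpair. }
    assert (Hhist : rec1 (fun x => hist (fst1 x) (snd1 x))).
    { unfold hist.
      apply (rec1_nat_rect snd1 (fun _ => 0) (fun x n h => cpair (step (fst1 x) n h) h));
        [rec1_auto|rec1_auto|].
      apply rec1_cpair; [|rec1_auto].
      eapply rec1_ext.
      - apply (rec1_comp _ (fun e => cpair (fst1 (snd1 (snd1 e)))
                 (cpair (fst1 e) (fst1 (snd1 e)))) Hstep). rec1_auto.
      - intros e; cbn. now unpair. }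
    eapply rec1_ext.
    + apply (rec1_comp _ (fun x => cpair (fst1 x) (cpair (snd1 x) (hist (fst1 x) (snd1 x)))) Hstep).
      rec1_auto.
    + intros e; cbn. now unpair.
  - intros e t.
    assert (Hbin : forall k a b, 0 < k ->
      step e (cpair k (cpair a b)) (hist e (cpair k (cpair a b))) =
      op e k (step e a (hist e a)) (step e b (hist e b))).
    { intros k a b Hk. destruct (cpair_gt k a b Hk) as [Ha Hb].
      unfold step at 1. rewrite fst1_cpair, snd1_cpair, fst1_cpair, snd1_cpair.
      rewrite !Hget by assumption.
      destruct (Nat.eqb_spec k 0); [lia|reflexivity]. }
    induction t; cbn [code tfold]; try (rewrite Hbin by lia; congruence).
    + unfold step. now rewrite fst1_cpair, snd1_cpair.
    + unfold step. rewrite fst1_cpair. cbn [Nat.eqb]. apply Hleaf. lia.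
    + unfold step. rewrite fst1_cpair. cbn [Nat.eqb]. apply Hleaf. lia.
    + unfold step. rewrite fst1_cpair. cbn [Nat.eqb]. apply Hleaf. lia.
Qed.

(** * The order on the natural numbers with top *)

Lemma leo_refl p : leo p p.
Proof. destruct p; cbn; auto. Qed.

Lemma leo_trans p q r : leo p q -> leo q r -> leo p r.
Proof. destruct p, q, r; cbn; auto; try easy; lia. Qed.

Lemma leo_antisym p q : leo p q -> leo q p -> p = q.
Proof. destruct p, q; cbn; try easy. intros; f_equal; lia. Qed.

Lemma leo_Omega p : leo p Omega.
Proof. now destruct p. Qed.

Lemma leo_0 p : leo (Fin 0) p.
Proof. destruct p; cbn; lia. Qed.

Lemma leo_total p q : leo p q \/ leo q p.
Proof. destruct p, q; cbn; auto; lia. Qed.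

Lemma leo_Omega_l p : leo Omega p -> p = Omega.
Proof. now destruct p. Qed.

Lemma not_leo_Fin n p : ~ leo p (Fin n) <-> leo (Fin (S n)) p.
Proof. destruct p; cbn; [lia|easy]. Qed.

Lemma all_Fin_Omega p : (forall n, leo (Fin n) p) -> p = Omega.
Proof. destruct p as [m|]; [|easy]. intros H. specialize (H (S m)). cbn in H. lia. Qed.

Lemma leo_ext p q : (forall x, leo x p <-> leo x q) -> p = q.
Proof. intros H. apply leo_antisym; apply H, leo_refl. Qed.

Lemma leo_mino x p q : leo x (mino p q) <-> leo x p /\ leo x q.
Proof. destruct x, p, q; cbn; try tauto; lia. Qed.

Lemma leo_maxo x p q : leo (maxo p q) x <-> leo p x /\ leo q x.
Proof. destruct x, p, q; cbn; try tauto; lia. Qed.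

Lemma mino_l p q : leo p q -> mino p q = p.
Proof. destruct p, q; cbn; try easy. intros; f_equal; lia. Qed.

Lemma mino_r p q : leo q p -> mino p q = q.
Proof. destruct p, q; cbn; try easy. intros; f_equal; lia. Qed.

Lemma maxo_l p q : leo q p -> maxo p q = p.
Proof. destruct p, q; cbn; try easy. intros; f_equal; lia. Qed.

Lemma maxo_r p q : leo p q -> maxo p q = q.
Proof. destruct p, q; cbn; try easy. intros; f_equal; lia. Qed.

(** * Suprema *)

Lemma least_nat (P : nat -> Prop) :
  (exists n, P n) -> exists n, P n /\ forall m, P m -> n <= m.
Proof.
  intros [n Hn].
  destruct (dec_inh_nat_subset_has_unique_least_element P) as [m [Hm _]];
    [intros k; apply classic|eauto|eauto].
Qed.

Lemma lub_exists (P : omb -> Prop) :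
  exists u, (forall x, P x -> leo x u) /\
            (forall w, (forall x, P x -> leo x w) -> leo u w).
Proof.
  destruct (classic (exists n, forall x, P x -> leo x (Fin n))) as [H|H].
  - apply least_nat in H as [n [Hn Hmin]]. exists (Fin n); split; [easy|].
    intros [m|] Hw; [exact (Hmin m Hw)|apply leo_Omega].
  - exists Omega; split; [auto using leo_Omega|].
    intros [m|] Hw; [|easy]. elim H. eauto.
Qed.

Definition lub (P : omb -> Prop) : omb :=
  proj1_sig (constructive_indefinite_description _ (lub_exists P)).

Lemma lub_ub (P : omb -> Prop) x : P x -> leo x (lub P).
Proof. unfold lub. destruct constructive_indefinite_description as [u [H1 H2]]; cbn; auto. Qed.

Lemma lub_le (P : omb -> Prop) w : (forall x, P x -> leo x w) -> leo (lub P) w.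
Proof. unfold lub. destruct constructive_indefinite_description as [u [H1 H2]]; cbn; auto. Qed.

(** Positive finite points are join-prime even for infinite suprema. For 0 the empty set is a
    counterexample, hence the successor. *)
Lemma leo_S_lub (P : omb -> Prop) n :
  leo (Fin (S n)) (lub P) -> exists x, P x /\ leo (Fin (S n)) x.
Proof.
  intros H. apply NNPP. intros H'. apply not_leo_Fin in H. apply H, lub_le.
  intros x Hx. apply NNPP. intros Hn. apply H'. exists x. split; [easy|].
  now apply not_leo_Fin.
Qed.

(** * Time warps *)

Lemma warp_mono f p q : is_warp f -> leo p q -> leo (f p) (f q).
Proof. intros [H _]. apply H. Qed.

Lemma warp_0 f : is_warp f -> f (Fin 0) = Fin 0.
Proof. now intros [_ [H _]]. Qed.

Lemma warp_sup f u : is_warp f -> (forall n, leo (f (Fin n)) u) -> leo (f Omega) u.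
Proof. intros [_ [_ [_ H]]]. apply H. Qed.

Lemma warp_exceeds f n :
  is_warp f -> leo (Fin n) (f Omega) -> exists m, leo (Fin n) (f (Fin m)).
Proof.
  intros Hf H. destruct n as [|n]; [exists 0; apply leo_0|].
  apply NNPP. intros H'. apply not_leo_Fin in H. apply H, warp_sup; [easy|].
  intros m. apply NNPP. intros Hm. apply H'. exists m. now apply not_leo_Fin.
Qed.

(** Continuity at omega yields preservation of all suprema, because a positive finite point below
    the supremum lies below some member. *)
Lemma warp_lub f (P : omb -> Prop) u :
  is_warp f -> (forall x, P x -> leo (f x) u) -> leo (f (lub P)) u.
Proof.
  intros Hf HP.
  assert (H : forall n, leo (Fin n) (lub P) -> leo (f (Fin n)) u).
  { intros [|n] Hn; [rewrite (warp_0 f Hf); apply leo_0|].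
    destruct (leo_S_lub P n Hn) as [x [Hx Hnx]].
    eapply leo_trans; [apply (warp_mono f _ _ Hf Hnx)|auto]. }
  destruct (lub P) as [n|]; [apply H, leo_refl|].
  apply (warp_sup f u Hf). intros n. apply H, leo_Omega.
Qed.

(** The least time warp whose value at [n] is above [x] whenever [h n x] with [n] positive.
    Positivity forces the value 0 at 0, and finiteness of [n] forces continuity at omega. Both
    residuals and the extension of a table have this form. *)
Definition hull (h : nat -> omb -> Prop) (p : omb) : omb :=
  lub (fun x => exists n, 0 < n /\ leo (Fin n) p /\ h n x).

Lemma hull_warp h : is_warp (hull h).
Proof.
  unfold hull. repeat split.
  - intros p q Hpq. apply lub_le. intros x (n & H0 & Hn & Hx). apply lub_ub.
    exists n. eauto using leo_trans.
  - apply leo_antisym; [|apply leo_0]. apply lub_le.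
    intros x (n & H0 & Hn & Hx). cbn in Hn. lia.
  - intros m. apply lub_le. intros x (n & H0 & Hn & Hx). apply lub_ub.
    exists n. eauto using leo_Omega.
  - intros u Hu. apply lub_le. intros x (n & H0 & Hn & Hx).
    eapply leo_trans; [|apply (Hu n)]. apply lub_ub. exists n. auto using leo_refl.
Qed.

(** At omega only the values of [g] at finite arguments count, since the residual must be a warp; it
    may lie below the largest [x] with [f x] under [g Omega]. *)
Definition ldivw (f g : warp_fun) : warp_fun :=
  hull (fun n x => leo (f x) (g (Fin n))).

(** The supremum of the common lower bounds expresses the infimum of [f q] over all [q] with [n]
    below [g q]. *)
Definition rdivw (f g : warp_fun) : warp_fun :=
  hull (fun n x => forall q, leo (Fin n) (g q) -> leo x (f q)).

Lemma ldivw_warp f g : is_warp (ldivw f g).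
Proof. apply hull_warp. Qed.

Lemma rdivw_warp f g : is_warp (rdivw f g).
Proof. apply hull_warp. Qed.

Lemma comp_warp f g : is_warp f -> is_warp g -> is_warp (fun p => f (g p)).
Proof.
  intros Hf Hg. repeat split.
  - intros. now apply warp_mono, warp_mono.
  - rewrite (warp_0 g Hg). now apply warp_0.
  - intros n. apply warp_mono, warp_mono; auto using leo_Omega.
  (* Either [g] reaches its finite supremum at a finite argument, or its values at finite arguments
     exceed every natural number. *)
  - intros u Hu. destruct (g Omega) as [m|] eqn:E.
    + destruct (warp_exceeds g m Hg) as [k Hk]; [rewrite E; apply leo_refl|].
      eapply leo_trans; [|apply (Hu k)]. now apply warp_mono.
    + apply (warp_sup f u Hf). intros n.
      destruct (warp_exceeds g n Hg) as [k Hk]; [rewrite E; apply leo_Omega|].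
      eapply leo_trans; [|apply (Hu k)]. now apply warp_mono.
Qed.

Lemma min_warp f g : is_warp f -> is_warp g -> is_warp (fun p => mino (f p) (g p)).
Proof.
  intros Hf Hg.
  assert (Hm : forall p q, leo p q -> leo (mino (f p) (g p)) (mino (f q) (g q))).
  { intros p q Hpq. pose proof (leo_refl (mino (f p) (g p))) as H.
    apply leo_mino in H as [H1 H2].
    apply leo_mino; split; [eapply leo_trans; [exact H1|]|eapply leo_trans; [exact H2|]];
      now apply warp_mono. }
  repeat split; auto.
  - now rewrite (warp_0 f Hf), (warp_0 g Hg).
  - intros n. apply Hm, leo_Omega.
  - intros u Hu.
    assert (H : forall k, leo (Fin k) (mino (f Omega) (g Omega)) -> leo (Fin k) u).
    { intros k Hk. apply leo_mino in Hk as [H1 H2].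
      (* A bound reached by [f] at [a] and by [g] at [b] is reached by both at [a + b]. *)
      destruct (warp_exceeds f k Hf H1) as [a Ha], (warp_exceeds g k Hg H2) as [b Hb].
      eapply leo_trans; [|apply (Hu (a + b))].
      apply leo_mino; split; [eapply leo_trans; [exact Ha|]|eapply leo_trans; [exact Hb|]];
        apply warp_mono; auto; cbn; lia. }
    destruct (mino (f Omega) (g Omega)) as [k|]; [apply H, leo_refl|].
    rewrite (all_Fin_Omega u); [easy|]. intros n. apply H, leo_Omega.
Qed.

Lemma max_warp f g : is_warp f -> is_warp g -> is_warp (fun p => maxo (f p) (g p)).
Proof.
  intros Hf Hg.
  assert (Hm : forall p q, leo p q -> leo (maxo (f p) (g p)) (maxo (f q) (g q))).
  { intros p q Hpq. pose proof (leo_refl (maxo (f q) (g q))) as H.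
    apply leo_maxo in H as [H1 H2].
    apply leo_maxo; split; [eapply leo_trans; [|exact H1]|eapply leo_trans; [|exact H2]];
      now apply warp_mono. }
  repeat split; auto.
  - now rewrite (warp_0 f Hf), (warp_0 g Hg).
  - intros n. apply Hm, leo_Omega.
  - intros u Hu. apply leo_maxo; split; apply warp_sup; auto; intros n;
      now apply (leo_maxo u (f (Fin n)) (g (Fin n))).
Qed.

Lemma id_warp : is_warp w_id.
Proof.
  unfold w_id; repeat split; auto.
  intros u Hu. rewrite (all_Fin_Omega u Hu). easy.
Qed.

Lemma bot_warp : is_warp w_bot.
Proof. unfold w_bot; repeat split; auto using leo_refl, leo_0. Qed.

Lemma top_warp : is_warp w_top.
Proof.
  unfold w_top; repeat split.
  - intros [[|p]|] [[|q]|]; cbn; auto; lia.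
  - intros n; apply leo_Omega.
  - intros u Hu. exact (Hu 1).
Qed.

Lemma warp_lew_fin f g : is_warp f -> is_warp g ->
  (forall n, 0 < n -> leo (f (Fin n)) (g (Fin n))) -> lew f g.
Proof.
  intros Hf Hg H.
  assert (H' : forall n, leo (f (Fin n)) (g (Fin n))).
  { intros [|n]; [rewrite (warp_0 f Hf); apply leo_0|apply H; lia]. }
  intros [n|]; [apply H'|]. apply warp_sup; auto. intros n.
  eapply leo_trans; [apply H'|]. apply warp_mono; auto using leo_Omega.
Qed.

(** [f] preserves suprema, so the supremum that defines the residual is itself a solution of the
    inequality. *)
Lemma ldivw_fin f g m x : is_warp f -> is_warp g -> 0 < m ->
  leo x (ldivw f g (Fin m)) <-> leo (f x) (g (Fin m)).
Proof.
  intros Hf Hg Hm. split; intros H.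
  - eapply leo_trans; [apply (warp_mono f _ _ Hf H)|]. apply warp_lub; auto.
    intros y (n & H0 & Hn & Hy). eapply leo_trans; [exact Hy|]. now apply warp_mono.
  - apply lub_ub. exists m. auto using leo_refl.
Qed.

Lemma ldivw_residual f g : is_warp f -> is_warp g ->
  forall k, is_warp k -> (lew k (ldivw f g) <-> lew (fun p => f (k p)) g).
Proof.
  intros Hf Hg k Hk. split; intros H; apply warp_lew_fin; auto using ldivw_warp, rdivw_warp, comp_warp;
    intros n Hn; apply (ldivw_fin f g n (k (Fin n))); auto; apply H.
Qed.

Lemma rdivw_residual f g : is_warp f -> is_warp g ->
  forall k, is_warp k -> (lew k (rdivw f g) <-> lew (fun p => k (g p)) f).
Proof.
  intros Hf Hg k Hk. split; intros H.
  - intros p.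
    assert (H' : forall n, leo (Fin n) (g p) -> leo (k (Fin n)) (f p)).
    { intros n Hn. eapply leo_trans; [apply H|]. apply lub_le.
      intros x (m & H0 & Hm & Hx). apply Hx. eauto using leo_trans. }
    destruct (g p) as [n|]; [apply H', leo_refl|].
    apply warp_sup; auto. intros n. apply H', leo_Omega.
  - apply warp_lew_fin; auto using ldivw_warp, rdivw_warp. intros n Hn.
    apply lub_ub. exists n. repeat split; auto using leo_refl.
    intros q Hq. eapply leo_trans; [apply (warp_mono k _ _ Hk Hq)|apply H].
Qed.

(** * Evaluation as a function *)

Fixpoint sem (v : nat -> warp_fun) (t : tterm) : warp_fun :=
  match t with
  | TVar n => v n
  | TMeet s u => fun p => mino (sem v s p) (sem v u p)
  | TJoin s u => fun p => maxo (sem v s p) (sem v u p)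
  | TComp s u => fun p => sem v s (sem v u p)
  | TLdiv s u => ldivw (sem v s) (sem v u)
  | TRdiv s u => rdivw (sem v s) (sem v u)
  | TId => w_id
  | TBot => w_bot
  | TTop => w_top
  end.

Lemma sem_warp v t : (forall n, is_warp (v n)) -> is_warp (sem v t).
Proof.
  intros Hv. induction t; cbn; auto using ldivw_warp, rdivw_warp, min_warp, max_warp, comp_warp,
    id_warp, bot_warp, top_warp.
Qed.

Lemma evalW_sem v t : (forall n, is_warp (v n)) -> evalW v t (sem v t).
Proof.
  intros Hv. pose proof (fun s => sem_warp v s Hv) as Hw.
  induction t; cbn; try (constructor; assumption).
  - apply ev_ldiv with (sem v t1) (sem v t2); auto using ldivw_warp, rdivw_warp.
    + now apply ldivw_residual.
  - apply ev_rdiv with (sem v t1) (sem v t2); auto using ldivw_warp, rdivw_warp.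
    + now apply rdivw_residual.
Qed.

(** The defining property determines a residual: two warps with the same warps below them lie below
    each other. *)
Lemma evalW_unique v t f : (forall n, is_warp (v n)) -> evalW v t f -> forall p, f p = sem v t p.
Proof.
  intros Hv He. pose proof (fun s => sem_warp v s Hv) as Hw.
  induction He as [n|s t f g _ IHf _ IHg|s t f g _ IHf _ IHg|s t f g _ IHf _ IHg
    |s t f g r _ IHf _ IHg Hr HR|s t f g r _ IHf _ IHg Hr HR| | |]; intros p; cbn; try easy.
  - now rewrite IHf, IHg.
  - now rewrite IHf, IHg.
  - now rewrite IHf, IHg.
  - assert (HR' : forall k, is_warp k -> (lew k r <-> lew k (ldivw (sem v s) (sem v t)))).
    { intros k Hk. rewrite HR, ldivw_residual by auto. unfold lew.
      split; intros H q; specialize (H q); now rewrite IHf, IHg in *. }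
    apply leo_antisym.
    + apply (HR' r Hr); intros q; apply leo_refl.
    + apply (HR' (ldivw (sem v s) (sem v t))); [auto using ldivw_warp, rdivw_warp|]; intros q; apply leo_refl.
  - assert (HR' : forall k, is_warp k -> (lew k r <-> lew k (rdivw (sem v s) (sem v t)))).
    { intros k Hk. rewrite HR, rdivw_residual by auto. unfold lew.
      split; intros H q; specialize (H q); now rewrite IHf, IHg in *. }
    apply leo_antisym.
    + apply (HR' r Hr); intros q; apply leo_refl.
    + apply (HR' (rdivw (sem v s) (sem v t))); [auto using ldivw_warp, rdivw_warp|]; intros q; apply leo_refl.
Qed.

Lemma W_models_sem s t :
  W_models s t <->
  forall v, (forall n, is_warp (v n)) -> forall p, sem v s p = sem v t p.
Proof.
  split.
  - intros H v Hv. apply (H v Hv); now apply evalW_sem.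
  - intros H v Hv f g Hf Hg p.
    now rewrite (evalW_unique v s f), (evalW_unique v t g), H.
Qed.

(** * Values of the residuals *)

Definition unbounded (f : warp_fun) : Prop :=
  f Omega = Omega /\ forall n, f (Fin n) <> Omega.

(** The dichotomy behind the flag. The witness is a successor because residuals are computed at
    positive points. *)
Lemma unbounded_or_attained f : is_warp f ->
  unbounded f \/ exists m, f (Fin (S m)) = f Omega.
Proof.
  intros Hf. destruct (f Omega) as [k|] eqn:E.
  - right. destruct (warp_exceeds f k Hf) as [m Hm]; [rewrite E; apply leo_refl|].
    exists m. apply leo_antisym.
    + rewrite <- E. apply warp_mono; auto using leo_Omega.
    + eapply leo_trans; [exact Hm|]. apply warp_mono; auto. cbn; lia.
  - destruct (classic (exists m, f (Fin m) = Omega)) as [[m Hm]|H].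
    + right. exists m. apply leo_Omega_l. rewrite <- Hm. apply warp_mono; auto. cbn; lia.
    + left. split; [easy|]. intros n Hn. apply H. eauto.
Qed.

Lemma ldivw_attained f g m x : is_warp f -> is_warp g -> 0 < m -> g (Fin m) = g Omega ->
  leo x (ldivw f g Omega) <-> leo (f x) (g Omega).
Proof.
  intros Hf Hg Hm E. rewrite <- E. rewrite <- (ldivw_fin f g m x Hf Hg Hm).
  assert (Hw : is_warp (ldivw f g)) by apply hull_warp.
  split; intros H; (eapply leo_trans; [exact H|]).
  - apply warp_sup; auto. intros n. apply lub_le. intros y (k & H0 & Hk & Hy).
    apply ldivw_fin; auto. rewrite E. eapply leo_trans; [exact Hy|].
    apply warp_mono; auto using leo_Omega.
  - apply warp_mono; auto using leo_Omega.
Qed.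

Lemma ldivw_unbounded f g x : is_warp f -> is_warp g -> unbounded g -> f x <> Omega ->
  leo x (ldivw f g Omega).
Proof.
  intros Hf Hg [Hu _] Hx. destruct (f x) as [k|] eqn:E; [|easy].
  destruct (warp_exceeds g k Hg) as [m Hm]; [rewrite Hu; apply leo_Omega|].
  apply lub_ub. exists (S m). repeat split; [lia|].
  rewrite E. eapply leo_trans; [exact Hm|]. apply warp_mono; auto. cbn; lia.
Qed.

(** An [x] above [a] has [f x = Omega], which is below no value of [g] at a finite argument. *)
Lemma ldivw_le f g a p : is_warp f -> is_warp g -> (forall n, g (Fin n) <> Omega) ->
  f (Fin (S a)) = Omega -> leo (ldivw f g p) (Fin a).
Proof.
  intros Hf Hg Hu E. apply lub_le. intros x (n & H0 & Hn & Hx).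
  apply NNPP. rewrite not_leo_Fin. intros H.
  pose proof (leo_trans _ _ _ (warp_mono f _ _ Hf H) Hx) as H'.
  rewrite E in H'. apply leo_Omega_l in H'. exact (Hu n H').
Qed.

Lemma ldivw_unbounded_Omega f g : is_warp f -> is_warp g -> unbounded g ->
  (forall n, f (Fin n) <> Omega) -> ldivw f g Omega = Omega.
Proof.
  intros Hf Hg Hu H. apply all_Fin_Omega. intros n. now apply ldivw_unbounded.
Qed.

Lemma ldivw_unbounded_Fin f g a : is_warp f -> is_warp g -> unbounded g ->
  f (Fin a) <> Omega -> f (Fin (S a)) = Omega -> ldivw f g Omega = Fin a.
Proof.
  intros Hf Hg Hu H E. apply leo_antisym.
  - apply ldivw_le; auto. apply Hu.
  - now apply ldivw_unbounded.
Qed.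

Lemma ldivw_is_unbounded f g : is_warp f -> is_warp g ->
  unbounded f -> unbounded g -> unbounded (ldivw f g).
Proof.
  intros Hf Hg [Hf1 Hf2] Hu. split; [now apply ldivw_unbounded_Omega|].
  intros [|n] E; [now rewrite (warp_0 _ (ldivw_warp _ _)) in E|].
  assert (H : leo Omega (ldivw f g (Fin (S n)))) by (rewrite E; apply leo_refl).
  apply ldivw_fin in H; auto; [|lia]. rewrite Hf1 in H. apply leo_Omega_l in H.
  now apply Hu in H.
Qed.

(** With [n] the successor of [g (Fin m)], every [q] with [n] below [g q] is at least [S m], so the
    infimum is the value of [f] there. *)
Lemma rdivw_step f g m p : is_warp f -> is_warp g ->
  ~ leo p (g (Fin m)) -> leo p (g (Fin (S m))) -> rdivw f g p = f (Fin (S m)).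
Proof.
  intros Hf Hg H1 H2. destruct (g (Fin m)) as [k|] eqn:E; [|now elim H1; apply leo_Omega].
  apply not_leo_Fin in H1. apply leo_antisym.
  - apply lub_le. intros x (n & H0 & Hn & Hx). apply Hx. eauto using leo_trans.
  - apply lub_ub. exists (S k). repeat split; [lia|easy|].
    intros q Hq. apply warp_mono; auto. apply not_leo_Fin. intros Hqm.
    apply (warp_mono g _ _ Hg) in Hqm. rewrite E in Hqm.
    apply (leo_trans _ _ _ Hq) in Hqm. cbn in Hqm. lia.
Qed.

Lemma rdivw_above f g p : is_warp f -> is_warp g ->
  ~ leo p (g Omega) -> rdivw f g p = Omega.
Proof.
  intros Hf Hg H. destruct (g Omega) as [k|] eqn:E; [|now elim H; apply leo_Omega].
  apply not_leo_Fin in H. apply leo_Omega_l, lub_ub. exists (S k).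
  repeat split; [lia|easy|]. intros q Hq.
  pose proof (leo_trans _ _ _ Hq (warp_mono g _ _ Hg (leo_Omega q))) as H'.
  rewrite E in H'. cbn in H'. lia.
Qed.

(** The choice [q = Omega] bounds the infimum from above. From below, a value of [g] beyond
    [g (Fin k)] forces an argument beyond [k]. *)
Lemma rdivw_unbounded f g : is_warp f -> is_warp g -> unbounded g ->
  rdivw f g Omega = f Omega.
Proof.
  intros Hf Hg [Hu1 Hu2]. apply leo_antisym.
  - apply lub_le. intros x (n & H0 & Hn & Hx). apply Hx. rewrite Hu1. apply leo_Omega.
  - apply warp_sup; auto. intros k. destruct (g (Fin k)) as [n|] eqn:E; [|now elim (Hu2 k)].
    apply lub_ub. exists (S n). repeat split; [lia|].
    intros q Hq. apply warp_mono; auto. destruct (leo_total (Fin k) q) as [H|H]; [easy|].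
    apply (warp_mono g _ _ Hg) in H. rewrite E in H.
    apply (leo_trans _ _ _ Hq) in H. cbn in H. lia.
Qed.

(** Locates [p] between consecutive values of [g], so that two neighbouring arguments settle the
    right residual at [p]. An unbounded [g] takes the value omega at no finite argument, hence the
    excluded case. *)
Lemma warp_step g p : is_warp g -> p <> Fin 0 -> leo p (g Omega) ->
  (p = Omega -> ~ unbounded g) ->
  exists m, ~ leo p (g (Fin m)) /\ leo p (g (Fin (S m))).
Proof.
  intros Hg H0 Hp Hu.
  assert (H : exists n, leo p (g (Fin n))).
  { destruct p as [n|]; [now apply warp_exceeds|].
    destruct (unbounded_or_attained g Hg) as [H|[m E]]; [now elim (Hu eq_refl)|].
    exists (S m). now rewrite E. }
  apply least_nat in H as [[|m] [Hm Hmin]].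
  - rewrite (warp_0 g Hg) in Hm. elim H0. apply leo_antisym; auto using leo_0.
  - exists m. split; [|easy]. intros H. apply Hmin in H. lia.
Qed.

Lemma rdivw_is_unbounded f g : is_warp f -> is_warp g ->
  unbounded f -> unbounded g -> unbounded (rdivw f g).
Proof.
  intros Hf Hg [Hf1 Hf2] Hu. split; [now rewrite rdivw_unbounded|].
  intros [|n] E; [now rewrite (warp_0 _ (rdivw_warp _ _)) in E|].
  destruct (warp_step g (Fin (S n)) Hg) as [m [H1 H2]]; try easy.
  - destruct Hu as [Hu _]. rewrite Hu. apply leo_Omega.
  - rewrite (rdivw_step f g m) in E; auto. now apply Hf2 in E.
Qed.

(** * Finite tables for time warps *)

Definition bex (W : nat) (P : nat -> bool) : bool := existsb P (seq 0 (S W)).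
Definition ball (W : nat) (P : nat -> bool) : bool := forallb P (seq 0 (S W)).

(* [W] stands for omega.  A table [T] asserts that a warp sends [i] to [a] for every
   pair with [rd T i a], and that it is unbounded with finite values when [fl W T];
   it need not list all values. *)
Definition rd (T i a : nat) : bool := get (get T i) a =? 1.
Definition fl (W T : nat) : bool := get (get T (S W)) 0 =? 1.
Definition mk (W : nat) (R : nat -> nat -> bool) (L : bool) : nat :=
  tab (S (S W)) (fun i => tab (S (S W)) (fun a => Nat.b2n (if i <=? W then R i a else L))).

Definition meet_rel W (R1 R2 : nat -> nat -> bool) i a :=
  bex W (fun x => bex W (fun y => R1 i x && R2 i y &&
    ((x <=? y) && (a =? x) || (y <=? x) && (a =? y)))).
Definition join_rel W (R1 R2 : nat -> nat -> bool) i a :=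
  bex W (fun x => bex W (fun y => R1 i x && R2 i y &&
    ((x <=? y) && (a =? y) || (y <=? x) && (a =? x)))).
Definition comp_rel W (R1 R2 : nat -> nat -> bool) i a :=
  bex W (fun q => R2 i q && R1 q a).
(* [a] is the largest point that the first warp maps below [b]. *)
Definition adj W (R1 : nat -> nat -> bool) b a :=
  (S a <? W) && bex W (fun c => bex W (fun d =>
     R1 a c && R1 (S a) d && (c <=? b) && (b <? d)))
  || (a =? W) && bex W (fun c => R1 W c && (c <=? b)).
(** The clauses treat 0; a positive finite [m], which also settles omega when the supremum of the
    second warp is attained at [m]; and omega under an unbounded second warp, split by whether the
    first warp stays finite at finite arguments. *)
Definition ldiv_rel W (R1 R2 : nat -> nat -> bool) (L1 L2 : bool) i a :=
  (i =? 0) && (a =? 0)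
  || bex W (fun m => bex W (fun b => (0 <? m) && (m <? W) && R2 m b &&
       ((m =? i) || (i =? W) && R2 W b) && adj W R1 b a))
  || (i =? W) && L2 &&
       ((a =? W) && (L1 || bex W (fun c => (c <? W) && R1 W c))
        || (S a <? W) && R1 (S a) W && bex W (fun c => (c <? W) && R1 a c)).
(** After the clause for 0, these are [rdivw_step], [rdivw_above] and [rdivw_unbounded]. The test
    [S m <? W] keeps both neighbours finite. *)
Definition rdiv_rel W (R1 R2 : nat -> nat -> bool) (L2 : bool) i a :=
  (i =? 0) && (a =? 0)
  || bex W (fun m => bex W (fun x => bex W (fun y => (S m <? W) && R2 m x && R2 (S m) y &&
       (x <? i) && (i <=? y) && R1 (S m) a)))
  || (a =? W) && bex W (fun y => R2 W y && (y <? i))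
  || (i =? W) && L2 && R1 W a.

Definition op_rel W k (R1 R2 : nat -> nat -> bool) (L1 L2 : bool) i a : bool :=
  if k =? 1 then meet_rel W R1 R2 i a
  else if k =? 2 then join_rel W R1 R2 i a
  else if k =? 3 then comp_rel W R1 R2 i a
  else if k =? 4 then ldiv_rel W R1 R2 L1 L2 i a
  else if k =? 5 then rdiv_rel W R1 R2 L2 i a
  else if k =? 6 then i =? a
  else if k =? 7 then a =? 0
  else (i =? 0) && (a =? 0) || (0 <? i) && (a =? W).

(** A meet is unbounded when both warps send omega to omega and one is unbounded; a join, when one
    is unbounded and the other stays finite at finite arguments; composites and residuals, when both
    are. *)
Definition op_flag W k (R1 R2 : nat -> nat -> bool) (L1 L2 : bool) : bool :=
  if k =? 1 then R1 W W && R2 W W && (L1 || L2)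
  else if k =? 2 then
    L1 && (L2 || bex W (fun q => (q <? W) && R2 W q))
    || L2 && bex W (fun q => (q <? W) && R1 W q)
  else if k <=? 5 then L1 && L2
  else k =? 6.

Definition op_table W k T1 T2 : nat :=
  mk W (op_rel W k (rd T1) (rd T2) (fl W T1) (fl W T2))
       (op_flag W k (rd T1) (rd T2) (fl W T1) (fl W T2)).

Definition table W c t : nat := tfold (get c) (op_table W) t.

(** The case [i = j] of monotonicity makes the listed relation single-valued. Without the flag the
    table must exhibit a finite point attaining the value at omega, which secures continuity of the
    extension. *)
Definition valid W T : bool :=
  ball W (fun i => ball W (fun j => ball W (fun a => ball W (fun b =>
    negb (rd T i a && rd T j b && (i <=? j)) || (a <=? b)))))
  && ball W (fun a => negb (rd T 0 a) || (a =? 0))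
  && (if fl W T
      then ball W (fun i => ball W (fun a => negb (rd T i a) ||
             ((i <? W) && (a <? W) || (i =? W) && (a =? W))))
      else bex W (fun i => bex W (fun a => (i <? W) && rd T i a && rd T W a))).

Arguments bex : simpl never.
Arguments ball : simpl never.
Arguments rd : simpl never.
Arguments fl : simpl never.
Arguments mk : simpl never.
Arguments meet_rel : simpl never.
Arguments join_rel : simpl never.
Arguments comp_rel : simpl never.
Arguments ldiv_rel : simpl never.
Arguments rdiv_rel : simpl never.

Lemma bex_true W P : bex W P = true <-> exists x, x <= W /\ P x = true.
Proof.
  unfold bex. rewrite existsb_exists. split; intros [x [Hx H]]; exists x; split; auto;
    apply in_seq || apply in_seq in Hx; lia.
Qed.

Lemma ball_true W P : ball W P = true <-> forall x, x <= W -> P x = true.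
Proof.
  unfold ball. rewrite forallb_forall. split; intros H x Hx; apply H;
    apply in_seq || apply in_seq in Hx; lia.
Qed.

Lemma rd_mk W R L i a : i <= W -> a <= W -> rd (mk W R L) i a = R i a.
Proof.
  intros Hi Ha. unfold rd, mk. rewrite !get_tab by lia.
  destruct (Nat.leb_spec i W); [|lia]. now destruct (R i a).
Qed.

Lemma fl_mk W R L : fl W (mk W R L) = L.
Proof.
  unfold fl, mk. rewrite !get_tab by lia.
  destruct (Nat.leb_spec (S W) W); [lia|]. now destruct L.
Qed.

Opaque bex ball rd fl.

Ltac reflectb := repeat (first
  [ setoid_rewrite orb_true_iff | setoid_rewrite andb_true_iff | setoid_rewrite bex_true
  | setoid_rewrite ball_true | setoid_rewrite Nat.ltb_lt | setoid_rewrite Nat.leb_le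
  | setoid_rewrite Nat.eqb_eq ]; cbv beta).

Lemma adj_true W R b a : adj W R b a = true <->
  S a < W /\ (exists c, c <= W /\ exists d, d <= W /\
    ((R a c = true /\ R (S a) d = true) /\ c <= b) /\ b < d)
  \/ a = W /\ (exists c, c <= W /\ R W c = true /\ c <= b).
Proof. unfold adj. now reflectb. Qed.

Opaque adj.

(** * Soundness of tables *)

Definition dec (W i : nat) : omb := if i <? W then Fin i else Omega.

(** Purely positive information, so soundness passes through each operation without knowledge of the
    warps elsewhere. *)
Definition sound (W T : nat) (f : warp_fun) : Prop :=
  (forall i a, i <= W -> a <= W -> rd T i a = true -> f (dec W i) = dec W a) /\
  (fl W T = true -> unbounded f).

Lemma dec_Fin W i : i < W -> dec W i = Fin i.
Proof. unfold dec. destruct (Nat.ltb_spec i W); [easy|lia]. Qed.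

Lemma dec_Omega W : dec W W = Omega.
Proof. unfold dec. destruct (Nat.ltb_spec W W); [lia|easy]. Qed.

Lemma dec_leo W i j : i <= W -> j <= W -> leo (dec W i) (dec W j) <-> i <= j.
Proof.
  unfold dec. intros. destruct (Nat.ltb_spec i W), (Nat.ltb_spec j W); cbn; lia.
Qed.

Lemma dec_not_leo W i j : i <= W -> j <= W -> ~ leo (dec W i) (dec W j) <-> j < i.
Proof. intros. rewrite dec_leo by easy. lia. Qed.

Lemma dec_not_Omega W i : i < W -> dec W i <> Omega.
Proof. intros. now rewrite dec_Fin. Qed.

Lemma sound_mk W R L f :
  (forall i a, i <= W -> a <= W -> R i a = true -> f (dec W i) = dec W a) ->
  (L = true -> unbounded f) -> sound W (mk W R L) f.
Proof.
  intros H1 H2. split; [intros i a Hi Ha|]; rewrite ?fl_mk, ?rd_mk; auto.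
Qed.

Section Soundness.

Context (W T1 T2 : nat) (f g : warp_fun).
Context (HW : 0 < W) (Hf : is_warp f) (Hg : is_warp g).
Context (H1 : sound W T1 f) (H2 : sound W T2 g).

Lemma sound_meet : sound W (op_table W 1 T1 T2) (fun p => mino (f p) (g p)).
Proof.
  destruct H1 as [R1 L1], H2 as [R2 L2]. apply sound_mk; cbn.
  - intros i a Hi Ha. unfold meet_rel. reflectb.
    intros (x & Hx & y & Hy & [Hix Hiy] & [[Hxy ->]|[Hxy ->]]);
      rewrite (R1 i x), (R2 i y) by assumption; [apply mino_l|apply mino_r]; now apply dec_leo.
  - reflectb. intros [[E1 E2] H]. apply R1 in E1; auto. apply R2 in E2; auto.
    rewrite dec_Omega in E1, E2.
    split; [now rewrite E1, E2|]. intros n.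
    destruct H as [H|H]; [apply L1 in H as [_ H]|apply L2 in H as [_ H]];
      specialize (H n); now destruct (f (Fin n)), (g (Fin n)).
Qed.

(** A finite value at omega bounds all values; for joins and left residuals this is the alternative
    to the flag. *)
Lemma finite_of_table T h : is_warp h -> sound W T h ->
  (exists q, q <= W /\ q < W /\ rd T W q = true) -> forall p, h p <> Omega.
Proof.
  intros Hh [R _] (q & Hq & HqW & H) p E. apply R in H; auto.
  rewrite dec_Omega, dec_Fin in H by easy.
  pose proof (warp_mono h p Omega Hh (leo_Omega p)) as Hp. now rewrite E, H in Hp.
Qed.

Lemma sound_join : sound W (op_table W 2 T1 T2) (fun p => maxo (f p) (g p)).
Proof.
  pose proof (finite_of_table _ _ Hf H1) as F1. pose proof (finite_of_table _ _ Hg H2) as F2.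
  destruct H1 as [R1 L1], H2 as [R2 L2]. apply sound_mk; cbn.
  - intros i a Hi Ha. unfold join_rel. reflectb.
    intros (x & Hx & y & Hy & [Hix Hiy] & [[Hxy ->]|[Hxy ->]]);
      rewrite (R1 i x), (R2 i y) by assumption; [apply maxo_r|apply maxo_l]; now apply dec_leo.
  - assert (Hmax : forall x y, x <> Omega -> y <> Omega -> maxo x y <> Omega)
      by now intros [] [].
    reflectb. intros [[H H']|[H H']].
    + apply L1 in H as [HO H]. split; [now rewrite HO|]. intros n. apply Hmax; auto.
      destruct H' as [H'|H']; [now apply L2|now apply F2].
    + apply L2 in H as [HO H]. split; [rewrite HO; now destruct (f Omega)|].
      intros n. apply Hmax; auto.
Qed.

Lemma sound_comp : sound W (op_table W 3 T1 T2) (fun p => f (g p)).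
Proof.
  destruct H1 as [R1 L1], H2 as [R2 L2]. apply sound_mk; cbn.
  - intros i a Hi Ha. unfold comp_rel. reflectb. intros (q & Hq & Hiq & Hqa).
    rewrite (R2 i q) by assumption. now apply R1.
  - reflectb. intros [E1 E2]. apply L1 in E1 as [A1 B1]. apply L2 in E2 as [A2 B2].
    split; [now rewrite A2|]. intros n. specialize (B2 n).
    destruct (g (Fin n)); [apply B1|easy].
Qed.

Lemma adj_sound b a r : b <= W -> a <= W -> adj W (rd T1) b a = true ->
  (forall x, leo x r <-> leo (f x) (dec W b)) -> r = dec W a.
Proof.
  destruct H1 as [R1 _]. intros Hb Ha. rewrite adj_true.
  intros [(Ha' & c & Hc & d & Hd & [[Hac Had] Hcb] & Hbd)|(-> & c & Hc & Hac & Hcb)] Hr.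
  - apply R1 in Hac, Had; try lia. rewrite dec_Fin in Hac, Had by lia.
    rewrite dec_Fin by lia. apply leo_antisym.
    + apply NNPP. rewrite not_leo_Fin, Hr, Had. now apply dec_not_leo.
    + rewrite Hr, Hac. now apply dec_leo.
  - apply R1 in Hac; auto. rewrite dec_Omega in *.
    apply leo_Omega_l. rewrite Hr, Hac. now apply dec_leo.
Qed.

Lemma sound_ldiv : sound W (op_table W 4 T1 T2) (ldivw f g).
Proof.
  pose proof (finite_of_table _ _ Hf H1) as F1. pose proof adj_sound as HA.
  destruct H1 as [R1 L1], H2 as [R2 L2]. apply sound_mk; cbn.
  - intros i a Hi Ha. unfold ldiv_rel. reflectb.
    intros [[[-> ->]|(m & Hm & b & Hb & [[[Hm0 HmW] Hmb] Hmi] & Hadj)]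
           |[[-> HL] [[-> H]|[[HaW HaO] (c & Hc & HcW & Hac)]]]].
    + rewrite dec_Fin by easy. apply warp_0, ldivw_warp.
    + apply HA with (r := ldivw f g (dec W i)) in Hadj; auto.
      intros x. apply R2 in Hmb; auto. rewrite dec_Fin in Hmb by easy.
      destruct Hmi as [->|[-> HWb]].
      * rewrite <- Hmb, dec_Fin by easy. now apply ldivw_fin.
      * apply R2 in HWb; auto. rewrite dec_Omega in *. rewrite <- HWb.
        apply ldivw_attained with m; congruence.
    + rewrite dec_Omega. apply ldivw_unbounded_Omega; auto. intros n.
      destruct H as [H|H]; [now apply L1|now apply F1].
    + apply R1 in HaO, Hac; try lia. rewrite dec_Omega in *.
      rewrite dec_Fin in HaO, Hac by lia. rewrite dec_Fin by lia.
      apply ldivw_unbounded_Fin; auto. rewrite Hac. now apply dec_not_Omega.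
  - reflectb. intros [E1 E2]. apply ldivw_is_unbounded; auto.
Qed.

Lemma sound_rdiv : sound W (op_table W 5 T1 T2) (rdivw f g).
Proof.
  destruct H1 as [R1 L1], H2 as [R2 L2]. apply sound_mk; cbn.
  - intros i a Hi Ha. unfold rdiv_rel. reflectb.
    intros [[[[-> ->]|(m & Hm & x & Hx & y & Hy & [[[[HmW Hmx] Hmy] Hxi] Hiy] & Hma)]
             |(-> & y & Hy & HWy & Hyi)]|[[-> HL] H]].
    + rewrite dec_Fin by easy. apply warp_0, rdivw_warp.
    + apply R1 in Hma; try lia. apply R2 in Hmx, Hmy; try lia.
      rewrite dec_Fin in Hma, Hmx, Hmy by lia.
      rewrite <- Hma. apply rdivw_step; auto; [rewrite Hmx|rewrite Hmy].
      * now apply dec_not_leo.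
      * now apply dec_leo.
    + apply R2 in HWy; auto. rewrite dec_Omega in *.
      apply rdivw_above; auto. rewrite HWy. now apply dec_not_leo.
    + apply R1 in H; auto. rewrite dec_Omega in *. rewrite <- H.
      apply rdivw_unbounded; auto.
  - reflectb. intros [E1 E2]. apply rdivw_is_unbounded; auto.
Qed.

End Soundness.

Lemma table_sound W V c v t : 0 < W -> (forall n, is_warp (v n)) ->
  (forall x, x < V -> sound W (get c x) (v x)) ->
  code t < V -> sound W (table W c t) (sem v t).
Proof.
  intros HW Hv Hc. pose proof (fun s => sem_warp v s Hv) as Hs.
  assert (Hbin : forall k s u, 0 < k -> cpair k (cpair (code s) (code u)) < V ->
                 code s < V /\ code u < V).
  { intros k s u Hk H. destruct (cpair_gt k (code s) (code u) Hk). lia. }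
  induction t; intros Ht; unfold table; cbn [code tfold sem] in *;
    try (apply Hbin in Ht as [Ht1 Ht2]; [|lia]).
  - apply Hc. pose proof (cpair_ge 0 n). lia.
  - apply sound_meet; auto.
  - apply sound_join; auto.
  - apply sound_comp; auto.
  - apply sound_ldiv; auto.
  - apply sound_rdiv; auto.
  - apply sound_mk; cbn.
    + intros i a Hi Ha. reflectb. now intros ->.
    + intros _. now split.
  - apply sound_mk; cbn; [|easy].
    intros i a Hi Ha. reflectb. intros ->. now rewrite (dec_Fin W 0).
  - apply sound_mk; cbn -[Nat.ltb]; [|easy].
    intros i a Hi Ha. reflectb. intros [[-> ->]|[Hi0 ->]].
    + now rewrite dec_Fin.
    + rewrite dec_Omega. unfold dec. destruct (i <? W); [|easy]. now destruct i.
Qed.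

Lemma lub_finite (P : omb -> Prop) N : (forall x, P x -> leo x (Fin N)) -> lub P <> Omega.
Proof. intros H E. apply lub_le in H. now rewrite E in H. Qed.

Lemma hull_attained h m a : (forall n x, 0 < n -> n <= m -> h n x -> leo x a) ->
  (exists n, 0 < n /\ n <= m /\ h n a) -> hull h (Fin m) = a.
Proof.
  intros H1 (n & H0 & Hn & Ha). apply leo_antisym.
  - apply lub_le. intros x (k & Hk0 & Hk & Hx). exact (H1 k x Hk0 Hk Hx).
  - apply lub_ub. now exists n.
Qed.

Lemma negb_or_true a b : negb a || b = true <-> (a = true -> b = true).
Proof. destruct a, b; cbn; intuition. Qed.

Lemma valid_spec W T : valid W T = true <->
  (forall i j a b, i <= W -> j <= W -> a <= W -> b <= W ->
     rd T i a = true -> rd T j b = true -> i <= j -> a <= b) /\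
  (forall a, a <= W -> rd T 0 a = true -> a = 0) /\
  (fl W T = true -> forall i a, i <= W -> a <= W -> rd T i a = true ->
     i < W /\ a < W \/ i = W /\ a = W) /\
  (fl W T = false -> exists i a, i < W /\ a <= W /\ rd T i a = true /\ rd T W a = true).
Proof.
  unfold valid. repeat setoid_rewrite andb_true_iff. repeat setoid_rewrite ball_true.
  cbv beta. repeat setoid_rewrite negb_or_true. reflectb.
  destruct (fl W T).
  - repeat setoid_rewrite ball_true. cbv beta. setoid_rewrite negb_or_true. reflectb.
    split.
    + intros [[Hm H0] H]. repeat split; [|easy|auto|easy].
      intros i j a b Hi Hj Ha Hb Hia Hjb Hij. apply (Hm i Hi j Hj); auto.
    + intros (Hm & H0 & H & _). repeat split; auto.
      intros i Hi j Hj a Ha b Hb [[Hia Hjb] Hij]. now apply (Hm i j).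
  - reflectb. split.
    + intros [[Hm H0] (i & Hi & a & Ha & [HiW Hia] & HWa)]. repeat split; [|easy|easy|].
      * intros k j c b Hk Hj Hc Hb Hkc Hjb Hkj. apply (Hm k Hk j Hj); auto.
      * intros _. now exists i, a.
    + intros (Hm & H0 & _ & H). repeat split; auto.
      * intros i Hi j Hj a Ha b Hb [[Hia Hjb] Hij]. now apply (Hm i j).
      * destruct (H eq_refl) as (i & a & Hi & Ha & Hia & HWa).
        exists i. split; [lia|]. now exists a.
Qed.

Lemma valid_sound W T : 0 < W -> valid W T = true -> exists f, is_warp f /\ sound W T f.
Proof.
  intros HW H. apply valid_spec in H as (mono & zero & Hflag & Hnoflag).
  (* Constant between listed points; past [W], of slope one if the flag demands it. *)
  set (h := fun n x => (n < W /\ exists a, a <= W /\ rd T n a = true /\ x = dec W a)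
                       \/ (fl W T = true /\ x = Fin (n - W))).
  assert (Hh : is_warp (hull h)) by apply hull_warp.
  assert (fin : forall i a, i < W -> a <= W -> rd T i a = true -> hull h (Fin i) = dec W a).
  { intros i a Hi Ha Hia. destruct i as [|i].
    - apply zero in Hia; auto. subst a. rewrite dec_Fin by easy. now apply warp_0.
    - apply hull_attained.
      + intros n x Hn0 Hn [[_ (b & Hb & Hnb & ->)]|[_ ->]].
        * apply dec_leo; auto. apply (mono n (S i)); auto; lia.
        (* Below [W] the slope-one part is truncated to 0 and cannot exceed a listed value. *)
        * replace (n - W) with 0 by lia. apply leo_0.
      + exists (S i). repeat split; [lia..|]. left. eauto. }
  exists (hull h). split; [easy|]. destruct (fl W T) eqn:EL.
  - specialize (Hflag eq_refl).
    assert (HO : hull h Omega = Omega).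
    (* The slope-one part reaches [n] at the argument [n + W]. *)
    { apply all_Fin_Omega. intros n. apply lub_ub. exists (n + W). repeat split; [lia|].
      right. split; auto. f_equal. lia. }
    split.
    + intros i a Hi Ha Hia. destruct (Hflag i a Hi Ha Hia) as [[Hi' _]|[-> ->]].
      * rewrite dec_Fin by easy. auto.
      * now rewrite dec_Omega.
    + intros _. split; [easy|]. intros n. apply lub_finite with (n + W).
      intros x (k & Hk0 & Hk & [[HkW (b & Hb & Hkb & ->)]|[_ ->]]).
      * destruct (Hflag k b) as [[_ Hb']|[? _]]; auto; [lia| |lia].
        rewrite dec_Fin by easy. cbn. lia.
      * cbn in *. lia.
  - split; [|now rewrite EL].
    destruct (Hnoflag eq_refl) as (i0 & a0 & Hi0 & Ha0 & Hia0 & HWa0).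
    assert (HO : hull h Omega = dec W a0).
    { apply leo_antisym.
      - apply lub_le. intros y (k & Hk0 & Hk & [[HkW (b & Hb & Hkb & ->)]|[? _]]); [|easy].
        apply dec_leo; auto. apply (mono k W); auto; lia.
      - rewrite <- (fin i0 a0) by auto. apply warp_mono; auto using leo_Omega. }
    intros i a Hi Ha Hia. destruct (Nat.eq_dec i W) as [->|Hne].
    + rewrite dec_Omega, HO. f_equal.
      apply Nat.le_antisymm; apply (mono W W); auto.
    + rewrite (dec_Fin W i) by lia. apply fin; auto; lia.
Qed.

(** * Completeness of tables *)

(** Repetitions in [X] do not count, so samples may be joined by concatenation. Points outside [X]
    have a rank too, as successors of sampled points require. *)
Definition rank (X : list nat) (n : nat) : nat :=
  length (filter (fun k => existsb (Nat.eqb k) X) (seq 0 n)).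

Lemma rank_S X n : rank X (1 + n) = rank X n + if existsb (Nat.eqb n) X then 1 else 0.
Proof.
  unfold rank. rewrite Nat.add_1_l, seq_S, filter_app, length_app. cbn.
  now destruct (existsb (Nat.eqb n) X).
Qed.

Lemma rank_succ X n : In n X -> rank X (1 + n) = 1 + rank X n.
Proof.
  intros H. rewrite rank_S. replace (existsb (Nat.eqb n) X) with true; [lia|].
  symmetry. apply existsb_exists. exists n. split; [easy|apply Nat.eqb_refl].
Qed.

Lemma rank_mono X m n : m <= n -> rank X m <= rank X n.
Proof.
  induction 1 as [|n _ IH]; [easy|]. pose proof (rank_S X n) as E.
  rewrite Nat.add_1_l in E. lia.
Qed.

Lemma rank_lt X m n : In m X -> m < n -> rank X m < rank X n.
Proof.
  intros H Hmn. apply rank_succ in H. pose proof (rank_mono X (1 + m) n Hmn). lia.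
Qed.

Lemma rank_le_length X n : rank X n <= length X.
Proof.
  unfold rank. apply NoDup_incl_length.
  - apply NoDup_filter, seq_NoDup.
  - intros k Hk. apply filter_In in Hk as [_ Hk]. apply existsb_exists in Hk as [x [Hx E]].
    apply Nat.eqb_eq in E. now subst.
Qed.

Definition asbool (P : Prop) : bool := if excluded_middle_informative P then true else false.

Lemma asbool_true P : asbool P = true <-> P.
Proof. unfold asbool. destruct excluded_middle_informative; easy. Qed.

Definition inS (X : list nat) (p : omb) : Prop :=
  match p with Fin n => In n X | Omega => True end.

Definition enc (W : nat) (X : list nat) (p : omb) : nat :=
  match p with Fin n => rank X n | Omega => W end.

Lemma enc_le W X p : length X < W -> enc W X p <= W.
Proof. destruct p as [n|]; cbn; [|easy]. pose proof (rank_le_length X n). lia. Qed.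

Lemma enc_Fin_lt W X n : length X < W -> enc W X (Fin n) < W.
Proof. cbn. pose proof (rank_le_length X n). lia. Qed.

Lemma enc_mono W X p q : length X < W -> leo p q -> enc W X p <= enc W X q.
Proof.
  intros HW. destruct p as [m|], q as [n|]; try easy.
  - apply rank_mono.
  - intros _. now apply (enc_le W X (Fin m)).
Qed.

(** A sampled finite [p] is counted below [q] but not below itself. *)
Lemma enc_lt W X p q : length X < W -> inS X p -> ~ leo q p -> enc W X p < enc W X q.
Proof.
  intros HW. destruct p as [m|], q as [n|]; cbn; try easy.
  - intros. apply rank_lt; [easy|lia].
  - intros _ _. now apply (enc_Fin_lt W X m).
Qed.

Lemma enc_leo W X p q : length X < W -> inS X q -> enc W X p <= enc W X q -> leo p q.
Proof.
  intros HW Hq H. apply NNPP. intros H'. apply (enc_lt W X q p) in H'; auto. lia.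
Qed.

Lemma enc_inj W X p q : length X < W -> inS X p -> inS X q -> enc W X p = enc W X q -> p = q.
Proof. intros HW Hp Hq E. apply leo_antisym; apply (enc_leo W X); auto; lia. Qed.

Lemma enc_0 W X : enc W X (Fin 0) = 0.
Proof. reflexivity. Qed.

Lemma enc_S W X n : In n X -> enc W X (Fin (1 + n)) = 1 + enc W X (Fin n).
Proof. apply rank_succ. Qed.

(* [Cov W n P]: some [n] sample points are enough to make [P] true. *)
Definition Cov (W n : nat) (P : list nat -> Prop) : Prop :=
  exists S0, length S0 <= n /\ forall X, incl S0 X -> length X < W -> P X.

Lemma Cov_and W n m P Q : Cov W n P -> Cov W m Q -> Cov W (n + m) (fun X => P X /\ Q X).
Proof.
  intros (S1 & L1 & H1) (S2 & L2 & H2). exists (S1 ++ S2). rewrite length_app.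
  split; [lia|]. intros X HS HW. apply incl_app_inv in HS as [HS1 HS2]. auto.
Qed.

Lemma Cov_impl W n m (P Q : list nat -> Prop) :
  n <= m -> (forall X, length X < W -> P X -> Q X) -> Cov W n P -> Cov W m Q.
Proof.
  intros Hnm H (S0 & L & HS0). exists S0. split; [lia|]. auto.
Qed.

Lemma Cov_in W p : Cov W 1 (fun X => inS X p).
Proof.
  destruct p as [k|].
  - exists [k]. split; [easy|]. intros X HS _. apply HS. now left.
  - exists []. split; [cbn; lia|]. easy.
Qed.

Lemma Cov_forall W n V (P : nat -> list nat -> Prop) :
  (forall x, x < V -> Cov W n (P x)) -> Cov W (n * V) (fun X => forall x, x < V -> P x X).
Proof.
  induction V as [|V IH]; intros H.
  - exists []. split; [cbn; lia|]. easy.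
  - specialize (IH (fun x Hx => H x (Nat.lt_lt_succ_r _ _ Hx))).
    specialize (H V (Nat.lt_succ_diag_r V)).
    refine (Cov_impl _ _ _ _ _ _ _ (Cov_and _ _ _ _ _ IH H)); [lia|].
    intros X _ [A B] x Hx. destruct (Nat.eq_dec x V) as [->|]; [easy|apply A; lia].
Qed.

Definition point (W : nat) (T : list nat -> nat) (f : warp_fun) (p : omb) (X : list nat) : Prop :=
  inS X p /\ inS X (f p) /\ rd (T X) (enc W X p) (enc W X (f p)) = true.

(** Each point has its own sample; only the bound on the size is uniform. *)
Definition complete (W n : nat) (T : list nat -> nat) (f : warp_fun) : Prop :=
  (forall p, Cov W n (point W T f p)) /\ (unbounded f -> Cov W n (fun X => fl W (T X) = true)).

Lemma complete_mk W n R L f :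
  (forall p, Cov W n (fun X => inS X p /\ inS X (f p) /\
     R X (enc W X p) (enc W X (f p)) = true)) ->
  (unbounded f -> Cov W n (fun X => L X = true)) ->
  complete W n (fun X => mk W (R X) (L X)) f.
Proof.
  intros H1 H2. split.
  - intros p. eapply Cov_impl; [apply le_n| |apply (H1 p)].
    intros X HS (A & B & C). repeat split; auto. rewrite rd_mk; auto using enc_le.
  - intros Hu. eapply Cov_impl; [apply le_n| |apply (H2 Hu)].
    intros X HS E. now rewrite fl_mk.
Qed.

Ltac cov H := refine (Cov_impl _ _ _ _ _ _ _ H); [lia|].

Section Completeness.

Context (W n1 n2 : nat) (T1 T2 : list nat -> nat) (f g : warp_fun).
Context (Hf : is_warp f) (Hg : is_warp g).
Context (H1 : complete W n1 T1 f) (H2 : complete W n2 T2 g).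

(** A common bound for all operations. The left residual asks for up to [2 * n1 + 2 * n2 + 1]
    points: two neighbours for [f], an argument and omega for [g], and 0. *)
Let N := 4 * (n1 + n2) + 4.

Lemma inS_mino X p q : inS X p -> inS X q -> inS X (mino p q).
Proof. destruct (leo_total p q); [rewrite mino_l|rewrite mino_r]; auto. Qed.

Lemma inS_maxo X p q : inS X p -> inS X q -> inS X (maxo p q).
Proof. destruct (leo_total p q); [rewrite maxo_r|rewrite maxo_l]; auto. Qed.

Lemma complete_meet : complete W N (fun X => op_table W 1 (T1 X) (T2 X)) (fun p => mino (f p) (g p)).
Proof.
  destruct H1 as [P1 L1], H2 as [P2 L2]. unfold op_table.
  apply (complete_mk W N (fun X => op_rel _ _ _ _ _ _) (fun X => op_flag _ _ _ _ _ _)); cbn.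
  - intros p. cov (Cov_and _ _ _ _ _ (P1 p) (P2 p)).
    intros X HS [(A1 & B1 & C1) (A2 & B2 & C2)]. split; [easy|]. split; [now apply inS_mino|].
    unfold meet_rel. reflectb.
    exists (enc W X (f p)). split; [now apply enc_le|].
    exists (enc W X (g p)). split; [now apply enc_le|]. split; [easy|].
    destruct (leo_total (f p) (g p)) as [H|H]; [left; rewrite mino_l|right; rewrite mino_r];
      auto using enc_mono.
  - intros [HO Hu].
    assert (Hf1 : f Omega = Omega) by now destruct (f Omega), (g Omega).
    assert (Hg1 : g Omega = Omega) by now destruct (f Omega), (g Omega).
    assert (HL : unbounded f \/ unbounded g).
    { apply NNPP. intros H. apply not_or_and in H as [Nf Ng].
      destruct (unbounded_or_attained f Hf) as [|[a Ha]]; [easy|].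
      destruct (unbounded_or_attained g Hg) as [|[b Hb]]; [easy|].
      (* If both warps reach omega at finite arguments, their meet does so at any argument beyond
         both. *)
      apply (Hu (S a + S b)). apply leo_Omega_l, leo_mino. split.
      - rewrite <- Hf1, <- Ha. apply warp_mono; auto. cbn; lia.
      - rewrite <- Hg1, <- Hb. apply warp_mono; auto. cbn; lia. }
    assert (HC : Cov W (n1 + n2) (fun X => (fl W (T1 X) || fl W (T2 X)) = true)).
    { destruct HL as [HL|HL]; [cov (L1 HL)|cov (L2 HL)]; intros X _ ->; auto using orb_true_r. }
    cov (Cov_and _ _ _ _ _ (Cov_and _ _ _ _ _ (P1 Omega) (P2 Omega)) HC).
    intros X HS [[(_ & _ & C1) (_ & _ & C2)] ->].
    rewrite Hf1 in C1. rewrite Hg1 in C2. cbn in C1, C2. now rewrite C1, C2.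
Qed.

Lemma flag_or_finite m T h : is_warp h -> complete W m T h -> (forall n, h (Fin n) <> Omega) ->
  Cov W m (fun X => fl W (T X) = true \/
                    exists q, q <= W /\ q < W /\ rd (T X) W q = true).
Proof.
  intros Hh [P L] H. destruct (h Omega) as [k|] eqn:E.
  - cov (P Omega). intros X HS (_ & _ & C). right. rewrite E in C. cbn in C.
    pose proof (enc_Fin_lt W X k HS). exists (enc W X (Fin k)). repeat split; auto. lia.
  - cov (L (conj E H)). auto.
Qed.

Lemma complete_join : complete W N (fun X => op_table W 2 (T1 X) (T2 X)) (fun p => maxo (f p) (g p)).
Proof.
  pose proof (flag_or_finite _ _ _ Hf H1) as F1. pose proof (flag_or_finite _ _ _ Hg H2) as F2.
  destruct H1 as [P1 L1], H2 as [P2 L2]. unfold op_table.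
  apply (complete_mk W N (fun X => op_rel _ _ _ _ _ _) (fun X => op_flag _ _ _ _ _ _)); cbn.
  - intros p. cov (Cov_and _ _ _ _ _ (P1 p) (P2 p)).
    intros X HS [(A1 & B1 & C1) (A2 & B2 & C2)]. split; [easy|]. split; [now apply inS_maxo|].
    unfold join_rel. reflectb.
    exists (enc W X (f p)). split; [now apply enc_le|].
    exists (enc W X (g p)). split; [now apply enc_le|]. split; [easy|].
    destruct (leo_total (f p) (g p)) as [H|H]; [left; rewrite maxo_r|right; rewrite maxo_l];
      auto using enc_mono.
  - intros [HO Hu].
    assert (Hf2 : forall n, f (Fin n) <> Omega).
    { intros n E. apply (Hu n). now rewrite E. }
    assert (Hg2 : forall n, g (Fin n) <> Omega).
    { intros n E. apply (Hu n). rewrite E. now destruct (f (Fin n)). }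
    assert (HL : f Omega = Omega \/ g Omega = Omega).
    { now destruct (f Omega), (g Omega); auto. }
    destruct HL as [HL|HL].
    + cov (Cov_and _ _ _ _ _ (L1 (conj HL Hf2)) (F2 Hg2)). intros X _ H. reflectb. auto.
    + cov (Cov_and _ _ _ _ _ (F1 Hf2) (L2 (conj HL Hg2))). intros X _ [[H|H] H']; reflectb; auto.
Qed.

Lemma complete_comp : complete W N (fun X => op_table W 3 (T1 X) (T2 X)) (fun p => f (g p)).
Proof.
  destruct H1 as [P1 L1], H2 as [P2 L2]. unfold op_table.
  apply (complete_mk W N (fun X => op_rel _ _ _ _ _ _) (fun X => op_flag _ _ _ _ _ _)); cbn.
  - intros p. cov (Cov_and _ _ _ _ _ (P1 (g p)) (P2 p)).
    intros X HS [(A1 & B1 & C1) (A2 & B2 & C2)]. split; [easy|]. split; [easy|].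
    unfold comp_rel. reflectb. exists (enc W X (g p)). auto using enc_le.
  - intros [HO Hu].
    assert (Hg2 : forall n, g (Fin n) <> Omega).
    { intros n E. apply (Hu n). rewrite E. apply leo_Omega_l.
      pose proof (warp_mono f (g Omega) Omega Hf (leo_Omega _)) as H. now rewrite HO in H. }
    assert (Hg1 : g Omega = Omega).
    { destruct (unbounded_or_attained g Hg) as [[H _]|[m Hm]]; [easy|].
      rewrite <- Hm in HO. now elim (Hu (S m)). }
    assert (Hf1 : f Omega = Omega) by congruence.
    assert (Hf2 : forall n, f (Fin n) <> Omega).
    { intros n E. destruct (warp_exceeds g n Hg) as [m Hm]; [rewrite Hg1; apply leo_Omega|].
      apply (Hu m). apply leo_Omega_l. rewrite <- E. now apply warp_mono. }
    cov (Cov_and _ _ _ _ _ (L1 (conj Hf1 Hf2)) (L2 (conj Hg1 Hg2))).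
    intros X _ [-> ->]. reflexivity.
Qed.

(** The values of [f] at a finite [r] and at its successor enclose [b]. That [b] is sampled remains
    a premise, to be supplied by the sample for [g]. *)
Lemma adj_complete b r : (forall x, leo x r <-> leo (f x) b) ->
  Cov W (2 * n1) (fun X => inS X r /\
    (inS X b -> adj W (rd (T1 X)) (enc W X b) (enc W X r) = true)).
Proof.
  intros Hr. destruct H1 as [P1 _]. destruct r as [a|].
  - cov (Cov_and _ _ _ _ _ (P1 (Fin a)) (P1 (Fin (1 + a)))).
    intros X HS [(A1 & B1 & C1) (A2 & B2 & C2)]. split; [easy|]. intros Hb.
    rewrite enc_S in C2 by easy.
    pose proof (enc_Fin_lt W X (1 + a) HS) as HaW. rewrite enc_S in HaW by easy.
    apply adj_true. left. split; [easy|].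
    exists (enc W X (f (Fin a))). split; [now apply enc_le|].
    exists (enc W X (f (Fin (1 + a)))). split; [now apply enc_le|].
    repeat split; auto.
    + apply enc_mono; [easy|]. apply Hr, leo_refl.
    + apply enc_lt; auto. rewrite <- Hr. apply not_leo_Fin, leo_refl.
  - cov (P1 Omega). intros X HS (A1 & B1 & C1). split; [easy|]. intros Hb.
    apply adj_true. right. split; [easy|]. exists (enc W X (f Omega)).
    split; [now apply enc_le|]. split; [easy|]. apply enc_mono; [easy|]. apply Hr, leo_refl.
Qed.

(** If [g] attained its supremum, the residual would attain its own at the same argument. If [f]
    were finite at omega, the residual would reach omega early; if [f] jumped to omega, the residual
    would be bounded. *)
Lemma ldiv_unbounded_parts : unbounded (ldivw f g) -> unbounded f /\ unbounded g.
Proof.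
  intros [HO Hu].
  assert (Hug : unbounded g).
  { destruct (unbounded_or_attained g Hg) as [H|[m Hm]]; [easy|]. elim (Hu (S m)).
    rewrite <- HO. apply leo_ext. intros x.
    rewrite (ldivw_attained f g (S m)), ldivw_fin, Hm by (auto; lia). easy. }
  split; [|easy]. destruct (unbounded_or_attained f Hf) as [H|[m Hm]]; [easy|].
  destruct (f Omega) as [k|] eqn:E.
  - destruct Hug as [Hg1 Hg2].
    destruct (warp_exceeds g k Hg) as [j Hj]; [rewrite Hg1; apply leo_Omega|].
    elim (Hu (S j)). apply leo_Omega_l. apply ldivw_fin; auto; [lia|]. rewrite E.
    eapply leo_trans; [exact Hj|]. apply warp_mono; auto. cbn; lia.
  - pose proof (ldivw_le f g m Omega Hf Hg (proj2 Hug) Hm) as H. now rewrite HO in H.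
Qed.

Lemma complete_ldiv : complete W N (fun X => op_table W 4 (T1 X) (T2 X)) (ldivw f g).
Proof.
  pose proof adj_complete as HA.
  destruct H1 as [P1 L1], H2 as [P2 L2]. unfold op_table.
  apply (complete_mk W N (fun X => op_rel _ _ _ _ _ _) (fun X => op_flag _ _ _ _ _ _)); cbn.
  - intros p.
    (* Covers at once a positive finite [p] and omega under an attained supremum: one value [b] of
       [g] at a finite [m] decides both. *)
    assert (Hatt : forall m b r, 0 < m -> g (Fin m) = b -> ldivw f g p = r ->
      (p = Fin m \/ p = Omega /\ g Omega = b) -> (forall x, leo x r <-> leo (f x) b) ->
      Cov W N (fun X => inS X p /\ inS X r /\
        ldiv_rel W (rd (T1 X)) (rd (T2 X)) (fl W (T1 X)) (fl W (T2 X))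
          (enc W X p) (enc W X r) = true)).
    { intros m b r Hm Hb Hr Hp Hx.
      cov (Cov_and _ _ _ _ _ (Cov_in W (Fin 0)) (Cov_and _ _ _ _ _ (P2 (Fin m))
             (Cov_and _ _ _ _ _ (P2 Omega) (HA b r Hx)))).
      intros X HS (Z & (A1 & B1 & C1) & (A2 & B2 & C2) & Hr1 & Hadj).
      split; [destruct Hp as [->|[-> _]]; easy|]. split; [easy|].
      rewrite Hb in *. specialize (Hadj B1).
      unfold ldiv_rel. reflectb. left; right.
      exists (enc W X (Fin m)). split; [now apply enc_le|].
      exists (enc W X b). split; [now apply enc_le|]. split; [|easy].
      split; [split; [split|easy]|].
      (* Sampling 0 makes the rank of the positive [m] positive. *)
      - apply (rank_lt X 0 m); auto.
      - now apply enc_Fin_lt.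
      - destruct Hp as [->|[-> E]]; [now left|right]. rewrite E in C2. easy. }
    destruct p as [[|m]|].
    + rewrite (warp_0 _ (ldivw_warp f g)). cov (Cov_in W (Fin 0)).
      intros X HS H0. split; [easy|]. split; [easy|]. reflexivity.
    + apply (Hatt (S m) (g (Fin (S m)))); auto; [lia|]. intros x. apply ldivw_fin; auto; lia.
    + destruct (unbounded_or_attained g Hg) as [Hu|[m Hm]].
      2: { apply (Hatt (S m) (g Omega)); auto; [lia|]. intros x.
           apply ldivw_attained with (S m); auto. lia. }
      destruct (classic (forall n, f (Fin n) <> Omega)) as [Hfin|Hfin].
      * rewrite ldivw_unbounded_Omega by auto.
        assert (HC : Cov W n1 (fun X => fl W (T1 X) = true \/
                       exists c, c <= W /\ c < W /\ rd (T1 X) W c = true))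
          by now apply (flag_or_finite n1 T1 f).
        cov (Cov_and _ _ _ _ _ (L2 Hu) HC). intros X HS [E H].
        split; [easy|]. split; [easy|]. unfold ldiv_rel. reflectb. right. auto.
      * assert (Hex : exists n, f (Fin n) = Omega).
        { apply NNPP. intros H. apply Hfin. intros n E. apply H. eauto. }
        (* The least argument sent to omega is a successor, since 0 goes to 0; its predecessor is
           the value of the residual. *)
        apply least_nat in Hex as [[|a] [Ha Hmin]]; [now rewrite (warp_0 f Hf) in Ha|].
        assert (Ha' : f (Fin a) <> Omega) by (intros E; apply Hmin in E; lia).
        rewrite (ldivw_unbounded_Fin f g a) by auto.
        cov (Cov_and _ _ _ _ _ (L2 Hu) (Cov_and _ _ _ _ _ (P1 (Fin a)) (P1 (Fin (1 + a))))).
        intros X HS (E & (A1 & B1 & C1) & (A2 & B2 & C2)).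
        split; [easy|]. split; [easy|]. unfold ldiv_rel. reflectb. right.
        split; [easy|]. right. pose proof (enc_Fin_lt W X (1 + a) HS) as HaW.
        change (f (Fin (1 + a)) = Omega) in Ha. rewrite Ha in C2.
        rewrite enc_S in C2, HaW by easy. split; [easy|].
        exists (enc W X (f (Fin a))). split; [now apply enc_le|]. split; [|easy].
        destruct (f (Fin a)); [now apply enc_Fin_lt|easy].
  - intros Hu. apply ldiv_unbounded_parts in Hu as [Hu1 Hu2].
    cov (Cov_and _ _ _ _ _ (L1 Hu1) (L2 Hu2)). intros X _ [-> ->]. reflexivity.
Qed.

(** Otherwise the value at omega is attained early: just past a finite [g Omega]; just past
    [g (Fin m)] if [g] jumps to omega after [m]; or just past [g (Fin n)] if [f] is omega at [n]. *)
Lemma rdiv_unbounded_parts : unbounded (rdivw f g) -> unbounded f /\ unbounded g.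
Proof.
  intros [HO Hu].
  assert (Hg1 : g Omega = Omega).
  { destruct (g Omega) as [k|] eqn:E; [|easy]. elim (Hu (S k)).
    apply rdivw_above; auto. rewrite E. cbn. lia. }
  assert (Hug : unbounded g).
  { destruct (classic (unbounded g)) as [H|H]; [easy|].
    destruct (warp_step g Omega Hg) as [m [A B]]; [easy|now rewrite Hg1|auto|].
    destruct (g (Fin m)) as [k|] eqn:E; [|now elim A].
    elim (Hu (S k)). rewrite (rdivw_step f g m); auto.
    - rewrite <- HO. symmetry. apply rdivw_step; auto. now rewrite E.
    - rewrite E. cbn. lia.
    - apply leo_Omega_l in B. rewrite B. apply leo_Omega. }
  split; [|easy]. split; [now rewrite rdivw_unbounded in HO|].
  intros n E. destruct (g (Fin n)) as [k|] eqn:Ek; [|now apply Hug in Ek].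
  apply (Hu (S k)). apply leo_Omega_l, lub_ub. exists (S k).
  repeat split; [lia|apply leo_refl|]. intros q Hq. rewrite <- E. apply warp_mono; auto.
  destruct (leo_total (Fin n) q) as [H|H]; [easy|].
  apply (warp_mono g _ _ Hg) in H. rewrite Ek in H.
  apply (leo_trans _ _ _ Hq) in H. cbn in H. lia.
Qed.

Lemma complete_rdiv : complete W N (fun X => op_table W 5 (T1 X) (T2 X)) (rdivw f g).
Proof.
  destruct H1 as [P1 L1], H2 as [P2 L2]. unfold op_table.
  apply (complete_mk W N (fun X => op_rel _ _ _ _ _ _) (fun X => op_flag _ _ _ _ _ _)); cbn.
  - intros p. destruct (classic (p = Fin 0)) as [->|Hp0].
    { rewrite (warp_0 _ (rdivw_warp f g)). cov (Cov_in W (Fin 0)).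
      intros X HS H0. split; [easy|]. split; [easy|]. reflexivity. }
    destruct (classic (leo p (g Omega))) as [Hp|Hp].
    2: { rewrite rdivw_above by auto. cov (Cov_and _ _ _ _ _ (Cov_in W p) (P2 Omega)).
         intros X HS [A (A2 & B2 & C2)]. split; [easy|]. split; [easy|].
         unfold rdiv_rel. reflectb. left; right. split; [easy|].
         exists (enc W X (g Omega)). split; [now apply enc_le|]. split; [easy|].
         now apply enc_lt. }
    destruct (classic (p = Omega /\ unbounded g)) as [[-> Hu]|Hpu].
    + rewrite rdivw_unbounded by auto. cov (Cov_and _ _ _ _ _ (L2 Hu) (P1 Omega)).
      intros X HS [E (A1 & B1 & C1)]. split; [easy|]. split; [easy|].
      unfold rdiv_rel. reflectb. auto.
    + destruct (warp_step g p Hg Hp0 Hp) as [m [A B]]; [now intros -> Hu; apply Hpu|].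
      rewrite (rdivw_step f g m) by auto.
      cov (Cov_and _ _ _ _ _ (Cov_in W p) (Cov_and _ _ _ _ _ (P1 (Fin (1 + m)))
             (Cov_and _ _ _ _ _ (P2 (Fin m)) (P2 (Fin (1 + m)))))).
      intros X HS (Ap & (A1 & B1 & C1) & (A2 & B2 & C2) & (A3 & B3 & C3)).
      split; [easy|]. split; [easy|]. unfold rdiv_rel. reflectb. left; left; right.
      pose proof (enc_Fin_lt W X (1 + m) HS) as HmW.
      rewrite enc_S in C1, C3, HmW by easy.
      exists (enc W X (Fin m)). split; [now apply enc_le|].
      exists (enc W X (g (Fin m))). split; [now apply enc_le|].
      exists (enc W X (g (Fin (1 + m)))). split; [now apply enc_le|].
      repeat split; auto.
      * now apply enc_lt.
      * now apply enc_mono.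
  - intros Hu. apply rdiv_unbounded_parts in Hu as [Hu1 Hu2].
    cov (Cov_and _ _ _ _ _ (L1 Hu1) (L2 Hu2)). intros X _ [-> ->]. reflexivity.
Qed.

End Completeness.

Lemma complete_id W : complete W 4 (fun _ => op_table W 6 0 0) w_id.
Proof.
  unfold op_table. apply (complete_mk W 4 (fun _ => op_rel _ _ _ _ _ _) (fun _ => op_flag _ _ _ _ _ _)).
  - intros p. cov (Cov_in W p). intros X HS Hp. split; [easy|]. split; [easy|].
    cbn. apply Nat.eqb_refl.
  - intros _. cov (Cov_in W Omega). reflexivity.
Qed.

Lemma complete_bot W : complete W 4 (fun _ => op_table W 7 0 0) w_bot.
Proof.
  unfold op_table. apply (complete_mk W 4 (fun _ => op_rel _ _ _ _ _ _) (fun _ => op_flag _ _ _ _ _ _)).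
  - intros p. cov (Cov_and _ _ _ _ _ (Cov_in W p) (Cov_in W (Fin 0))). easy.
  - intros [H _]. easy.
Qed.

Lemma complete_top W : complete W 4 (fun _ => op_table W 8 0 0) w_top.
Proof.
  unfold op_table. apply (complete_mk W 4 (fun _ => op_rel _ _ _ _ _ _) (fun _ => op_flag _ _ _ _ _ _)).
  - intros p. cov (Cov_and _ _ _ _ _ (Cov_in W (Fin 0)) (Cov_in W p)).
    intros X HS [H0 Hp]. split; [easy|].
    assert (HO : leo p (Fin 0) \/ w_top p = Omega) by (destruct p as [[|p]|]; cbn; auto; lia).
    destruct HO as [H|H].
    + rewrite (leo_antisym _ _ H (leo_0 p)). split; [easy|reflexivity].
    + rewrite H. split; [easy|]. unfold op_rel. cbn -[Nat.ltb]. reflectb. right.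
      split; [|easy]. apply (enc_lt W X (Fin 0) p); auto.
      intros E. rewrite (leo_antisym _ _ E (leo_0 p)) in H. easy.
  - intros [_ H]. now elim (H 1).
Qed.

(** Iterates the uniform bound for one operation; as a [tfold] it is recursive in the code. *)
Definition cost (t : tterm) : nat :=
  tfold (fun _ => 4) (fun k x y => if k <=? 5 then 4 * (x + y) + 4 else 4) t.

(** A strict bound [V] on the code also bounds the indices of the variables, so tables for the first
    [V] variables suffice. *)
Lemma table_complete W V c v t : (forall n, is_warp (v n)) ->
  (forall x, x < V -> complete W 4 (fun X => get (c X) x) (v x)) ->
  code t < V -> complete W (cost t) (fun X => table W (c X) t) (sem v t).
Proof.
  intros Hv Hc. pose proof (fun s => sem_warp v s Hv) as Hs.
  assert (Hbin : forall k s u, 0 < k -> cpair k (cpair (code s) (code u)) < V ->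
                 code s < V /\ code u < V).
  { intros k s u Hk H. destruct (cpair_gt k (code s) (code u) Hk). lia. }
  induction t; intros Ht; unfold table, cost; cbn [code tfold sem] in *;
    try (apply Hbin in Ht as [Ht1 Ht2]; [|lia]).
  - apply Hc. pose proof (cpair_ge 0 n). lia.
  - apply complete_meet; auto.
  - apply complete_join; auto.
  - apply complete_comp; auto.
  - apply complete_ldiv; auto.
  - apply complete_rdiv; auto.
  - apply complete_id.
  - apply complete_bot.
  - apply complete_top.
Qed.

(** * Sampled valuations *)

(** Defined classically and never computed: the search runs through all codes and only has to meet
    this one. *)
Definition sample_table W (f : warp_fun) (X : list nat) : nat :=
  mk W (fun i a => asbool (exists p, inS X p /\ inS X (f p) /\ i = enc W X p /\ a = enc W X (f p)))
       (asbool (unbounded f)).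

Lemma complete_sample W f : complete W 4 (sample_table W f) f.
Proof.
  apply (complete_mk W 4
    (fun X i a => asbool (exists p, inS X p /\ inS X (f p) /\ i = enc W X p /\ a = enc W X (f p)))
    (fun _ => asbool (unbounded f))).
  - intros p. cov (Cov_and _ _ _ _ _ (Cov_in W p) (Cov_in W (f p))).
    intros X HS [A B]. split; [easy|]. split; [easy|]. rewrite asbool_true. now exists p.
  - intros Hu. cov (Cov_in W Omega). intros X _ _. now rewrite asbool_true.
Qed.

(** Validity takes the point 0 and, unless the warp is unbounded, an argument attaining the value at
    omega together with that value. *)
Lemma valid_sample W f : is_warp f -> Cov W 4 (fun X => valid W (sample_table W f X) = true).
Proof.
  intros Hf.
  assert (HC : Cov W 2 (fun X => unbounded f \/
             exists m, In (1 + m) X /\ inS X (f Omega) /\ f (Fin (1 + m)) = f Omega)).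
  { destruct (unbounded_or_attained f Hf) as [H|[m Hm]].
    - cov (Cov_in W Omega). auto.
    - cov (Cov_and _ _ _ _ _ (Cov_in W (Fin (1 + m))) (Cov_in W (f Omega))).
      intros X _ [A B]. right. exists m. auto. }
  cov (Cov_and _ _ _ _ _ (Cov_in W (Fin 0)) HC). intros X HS [H0 H].
  assert (HR : forall i a, i <= W -> a <= W -> rd (sample_table W f X) i a = true ->
     exists p, inS X p /\ inS X (f p) /\ i = enc W X p /\ a = enc W X (f p)).
  { intros i a Hi Ha Hia. unfold sample_table in Hia. rewrite rd_mk in Hia by easy.
    exact (proj1 (asbool_true _) Hia). }
  assert (HR' : forall p, inS X p -> inS X (f p) ->
     rd (sample_table W f X) (enc W X p) (enc W X (f p)) = true).
  { intros p Hp Hfp. unfold sample_table. rewrite rd_mk by auto using enc_le.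
    apply asbool_true. now exists p. }
  apply valid_spec. repeat split.
  - intros i j a b Hi Hj Ha Hb Hia Hjb Hij.
    apply HR in Hia as (p & Hp & Hfp & -> & ->), Hjb as (q & Hq & Hfq & -> & ->); auto.
    apply enc_mono; auto. apply warp_mono; auto. now apply (enc_leo W X).
  - intros a Ha H1. apply HR in H1 as (p & Hp & Hfp & E & ->); [|lia|easy].
    rewrite <- (enc_0 W X) in E. apply enc_inj in E; auto. subst p.
    now rewrite (warp_0 f Hf).
  - unfold sample_table at 1. rewrite fl_mk, asbool_true. intros [HO Hu] i a Hi Ha Hia.
    apply HR in Hia as (p & Hp & Hfp & -> & ->); auto. destruct p as [n|].
    + left. split; [now apply enc_Fin_lt|]. specialize (Hu n).
      destruct (f (Fin n)); [now apply enc_Fin_lt|easy].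
    + right. now rewrite HO.
  - unfold sample_table at 1. rewrite fl_mk. intros E.
    destruct H as [H|(m & Hm & HO & Em)].
    { apply asbool_true in H. congruence. }
    exists (enc W X (Fin (1 + m))), (enc W X (f Omega)).
    split; [now apply enc_Fin_lt|]. split; [now apply enc_le|].
    split; [|now apply (HR' Omega)].
    rewrite <- Em in HO |- *. now apply HR'.
Qed.

(** * The decision procedure *)

(** The code of [V] tables with all entries 1, which dominates the code of every sampled
    valuation. *)
Definition bound (W V : nat) : nat :=
  tab V (fun _ => tab (S (S W)) (fun _ => tab (S (S W)) (fun _ => 1))).

Definition refutes (W V c : nat) (A B : nat) : bool :=
  forallb (fun x => valid W (get c x)) (seq 0 V) &&
  bex W (fun i => bex W (fun a => bex W (fun b => negb (a =? b) && (rd A i a && rd B i b)))).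

(** Any number that passes the validity test extends to a valuation, whether or not it arose from
    sampling; variables from [V] on receive the identity. *)
Lemma refutes_sound W V c s t : 0 < W -> code s < V -> code t < V ->
  refutes W V c (table W c s) (table W c t) = true -> ~ W_models s t.
Proof.
  intros HW Hs Ht H Hm. unfold refutes in H. apply andb_true_iff in H as [Hval H].
  rewrite forallb_forall in Hval.
  assert (Hv : exists v : nat -> warp_fun, forall x,
            is_warp (v x) /\ (x < V -> sound W (get c x) (v x))).
  { apply (choice (fun x f => is_warp f /\ (x < V -> sound W (get c x) f))).
    intros x. destruct (Nat.lt_ge_cases x V) as [Hx|Hx].
    - destruct (valid_sound W (get c x) HW) as (f & Hf & Hsf); [|now exists f].
      apply Hval, in_seq. lia.
    - exists w_id. split; [apply id_warp|lia]. }
  destruct Hv as [v Hv].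
  assert (Hw : forall x, is_warp (v x)) by apply Hv.
  destruct (table_sound W V c v s HW Hw) as [Rs _]; [apply Hv|easy|].
  destruct (table_sound W V c v t HW Hw) as [Rt _]; [apply Hv|easy|].
  apply bex_true in H as (i & Hi & H). apply bex_true in H as (a & Ha & H).
  apply bex_true in H as (b & Hb & H).
  apply andb_true_iff in H as [Hab H]. apply andb_true_iff in H as [Hia Hib].
  apply Rs in Hia; auto. apply Rt in Hib; auto.
  rewrite (proj1 (W_models_sem s t) Hm v Hw), Hib in Hia.
  apply negb_true_iff, Nat.eqb_neq in Hab. apply Hab.
  apply Nat.le_antisymm; apply (dec_leo W); auto; rewrite Hia; apply leo_refl.
Qed.

Lemma refutes_complete W V s t : 4 * V + 4 * V + (cost s + cost t) < W ->
  code s < V -> code t < V -> ~ W_models s t ->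
  exists c, c <= bound W V /\ refutes W V c (table W c s) (table W c t) = true.
Proof.
  intros HW Hs Ht H.
  assert (Hv : exists v p, (forall n, is_warp (v n)) /\ sem v s p <> sem v t p).
  { apply NNPP. intros H'. apply H, W_models_sem. intros v Hv p. apply NNPP. intros Hp.
    apply H'. now exists v, p. }
  destruct Hv as (v & p & Hv & Hp).
  set (c := fun X => tab V (fun x => sample_table W (v x) X)).
  assert (Hc : forall x, x < V -> complete W 4 (fun X => get (c X) x) (v x)).
  { intros x Hx. destruct (complete_sample W (v x)) as [A B].
    split; [intros q; refine (Cov_impl _ _ _ _ _ (le_n _) _ (A q))
           |intros Hu; refine (Cov_impl _ _ _ _ _ (le_n _) _ (B Hu))];
      intros X _; unfold point, c; now rewrite get_tab. }
  destruct (table_complete W V c v s Hv Hc Hs) as [Ps _].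
  destruct (table_complete W V c v t Hv Hc Ht) as [Pt _].
  (* At most [4 * V] points make the variable tables valid, and the two costs pay for both values at
     [p]; the total is below [W]. *)
  destruct (Cov_and _ _ _ _ _ (Cov_forall W 4 V _ (fun x _ => valid_sample W (v x) (Hv x)))
              (Cov_and _ _ _ _ _ (Ps p) (Pt p))) as (X & HS & HP).
  assert (HSW : length X < W) by lia.
  destruct (HP X (incl_refl X) HSW) as (Hval & (A1 & B1 & C1) & (A2 & B2 & C2)).
  exists (c X). split.
  - apply tab_mono. intros x. apply tab_mono. intros i. apply tab_mono. intros a.
    apply Nat.b2n_le_1.
  - unfold refutes. apply andb_true_iff. split.
    + apply forallb_forall. intros x Hx. apply in_seq in Hx. unfold c.
      rewrite get_tab by lia. apply Hval. lia.
    + apply bex_true. exists (enc W X p). split; [now apply enc_le|].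
      apply bex_true. exists (enc W X (sem v s p)). split; [now apply enc_le|].
      apply bex_true. exists (enc W X (sem v t p)). split; [now apply enc_le|].
      rewrite C1, C2, andb_true_r. apply negb_true_iff, Nat.eqb_neq.
      intros E. now apply enc_inj in E.
Qed.

Transparent bex ball rd fl adj.

Lemma rec1_op_table :
  rec1 (fun e => op_table (fst1 (fst1 e)) (fst1 (snd1 e))
                   (fst1 (snd1 (snd1 e))) (snd1 (snd1 (snd1 e)))).
Proof.
  unfold op_table, mk, op_rel, op_flag, meet_rel, join_rel, comp_rel, ldiv_rel, rdiv_rel, adj,
    fl, rd, bex; cbv beta.
  rec1_auto.
Qed.

Lemma rec1_cost :
  exists F, rec1 (fun x => F (fst1 x) (snd1 x)) /\ forall e t, F e (code t) = cost t.
Proof.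
  apply (rec1_tfold (fun _ _ => 4) (fun _ k x y => if k <=? 5 then 4 * (x + y) + 4 else 4)).
  - rec1_auto.
  - rec1_auto.
  - intros e k x y Hk. destruct (Nat.leb_spec k 5); [lia|easy].
Qed.

Lemma rec1_table :
  exists F, rec1 (fun x => F (fst1 x) (snd1 x)) /\
    forall W c t, F (cpair W c) (code t) = table W c t.
Proof.
  destruct (rec1_tfold (fun e => get (snd1 e)) (fun e => op_table (fst1 e))) as (F & HF & E).
  - rec1_auto.
  - exact rec1_op_table.
  (* From tag 6 on, neither the relation nor the flag consults the argument tables. *)
  - intros e k x y Hk. do 6 (destruct k as [|k]; [lia|]).
    unfold op_table, op_rel, op_flag. now destruct k as [|[|[|k]]].
  - exists F. split; [easy|]. intros W c t. rewrite E. unpair. reflexivity.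
Qed.

Lemma rec1_reval2 (F : nat -> nat -> nat) : rec1 (fun e => F (fst1 e) (snd1 e)) -> rec2 F.
Proof.
  intros [r Hr]. destruct rec2_cpair as [p Hp].
  exists (RComp r [RComp p [RProj 0; RProj 1]]). intros x y.
  eapply reval_comp1.
  - eapply reval_comp2; [apply re_proj|apply re_proj|apply Hp].
  - specialize (Hr (cpair x y)). now rewrite fst1_cpair, snd1_cpair in Hr.
Qed.

Theorem theorem1p1 :
  exists P : recf, forall s t : tterm,
    (W_models s t -> reval P [code s; code t] 1) /\
    (~ W_models s t -> reval P [code s; code t] 0).
Proof.
  destruct rec1_cost as (F & HF & EF), rec1_table as (G & HG & EG).
  set (V := fun e => S (fst1 e + snd1 e)).
  set (W := fun e => S (4 * V e + 4 * V e + (F 0 (fst1 e) + F 0 (snd1 e)))).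
  set (answer := fun x y => let e := cpair x y in
    Nat.b2n (negb (existsb (fun c => refutes (W e) (V e) c
      (G (cpair (W e) c) (fst1 e)) (G (cpair (W e) c) (snd1 e)))
      (seq 0 (S (bound (W e) (V e))))))).
  assert (HV : rec1 V) by (unfold V; rec1_auto).
  assert (HW : rec1 W) by (unfold W; rec1_auto).
  assert (Hanswer : rec2 answer).
  { apply rec1_reval2. unfold answer. clearbody V W. clear answer.
    (* Pairing the two components of the input again returns the input itself. *)
    eapply rec1_ext; [|intros e; cbv zeta; rewrite cpair_eta; reflexivity].
    unfold refutes, valid, bound, ball, bex, fl, rd; cbv beta. rec1_auto. }
  destruct Hanswer as [P HP]. exists P. intros s t.
  specialize (HP (code s) (code t)). unfold answer in HP. cbv zeta in HP.
  set (e := cpair (code s) (code t)) in *.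
  assert (Es : fst1 e = code s) by apply fst1_cpair.
  assert (Et : snd1 e = code t) by apply snd1_cpair.
  assert (EV : V e = S (code s + code t)) by (unfold V; congruence).
  assert (EW : W e = S (4 * V e + 4 * V e + (cost s + cost t))).
  { unfold W. now rewrite Es, Et, !EF. }
  rewrite Es, Et in HP. clearbody V W e.
  (* Each outcome of the search contradicts the premise of one implication and gives the output
     required by the other. *)
  destruct existsb eqn:Hex; cbn [negb Nat.b2n] in HP.
  - apply existsb_exists in Hex as (c & _ & Hc).
    rewrite !EG in Hc. apply refutes_sound in Hc; [|lia..]. easy.
  - split; [easy|]. intros H. exfalso.
    destruct (refutes_complete (W e) (V e) s t) as (c & Hc & Hr); [lia..|easy|].
    enough (Hex' : true = false) by easy. rewrite <- Hex. symmetry.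
    apply existsb_exists. exists c. rewrite !EG. split; [|easy]. apply in_seq. lia.
Qed.
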